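(* Let $\nu \in \mathcal{P}_2(\mathbb{R}^d)$, and let $U, U_\delta : H \to \mathbb{R}$ ($\delta\in(0,1)$) be the functions $U(X) = W_2^2(\mathcal{L}(X),\nu)$ and $U_\delta(X) = \sup_{X'\in H}\{U(X') - \frac1\delta\|X-X'\|^2\}$. Let $X_0 \in H$ be such that $U$ is (Fréchet) differentiable at $X_0$, and let $(X_\delta)_{\delta\in(0,1)}$ be a family in $H$ such that $\|X_\delta - X_0\| \to 0$ as $\delta\to 0$. Then $$\lim_{\delta\to 0} \nabla U_\delta(X_\delta) = \nabla U(X_0)$$ (strongly in $H$).
   Context: $\mathcal{P}_2(\mathbb{R}^d)$ is the set of Borel probability measures on $\mathbb{R}^d$ with finite second moment, with the Wasserstein distance $W_2^2(\mu,\nu)=\inf_{\gamma\in\Pi(\mu,\nu)}\int|x-y|^2\gamma(dx,dy)$, where $\Pi(\mu,\nu)$ is the set of couplings of $\mu$ and $\nu$. $(\Omega,\mathcal{A},\mathbb{P})$ is a standard atomless probability space, $H=L^2(\Omega,\mathbb{R}^d)$ is the Hilbert space of square-integrable $\mathbb{R}^d$-valued random variables with $\langle X,Y\rangle=\mathbb{E}[X\cdot Y]$ and norm $\|\cdot\|$, and $\mathcal{L}(X)$ is the law of $X$. One has equivalently $U_\delta(X)=\Phi_\delta(\mathcal{L}(X))$ with $\Phi_\delta(\mu)=\sup_{\mu'\in\mathcal{P}_2(\mathbb{R}^d)}\{W_2^2(\mu',\nu)-\frac1\delta W_2^2(\mu',\mu)\}$. For every $\delta\in(0,1)$ the function $U_\delta$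 is differentiable everywhere on $H$, with gradient $\nabla U_\delta$. *)

(* Defs.v *)
From HB Require Import structures.
From mathcomp Require Import all_boot all_order all_algebra.
From mathcomp Require Import generic_quotient ring_quotient.
From mathcomp Require Import all_classical all_reals all_analysis.
From mathcomp Require Import measurable_realfun.
From mathcomp Require Import ring lra.
Import Order.TTheory GRing.Theory Num.Theory.
Import numFieldNormedType.Exports.

Set Implicit Arguments.
Unset Strict Implicit.
Unset Printing Implicit Defensive.

Local Open Scope classical_set_scope.
Local Open Scope ring_scope.


Section borel_rV.
Context (R : realType) (d : nat).

HB.instance Definition _ :=
  Measurable.copy 'rV[R]_d (g_sigma_algebraType (@open 'rV[R]_d)).

Lemma measurable_coord (i : 'I_d) :
  measurable_fun setT (fun u : 'rV[R]_d => u 0 i).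
Proof.
apply: (measurability _ (RGenOpens.measurableE R)) => _ [_ [a [b ->]] <-].
rewrite setTI; apply: sub_sigma_algebra.
have /continuousP := @coord_continuous R 1 d 0 i.
by apply; exact: interval_open.
Qed.

Lemma measurable_fun_rVP d0 (T : measurableType d0) (f : T -> 'rV[R]_d) :
  measurable_fun setT f <-> forall i, measurable_fun setT (fun w => f w 0 i).
Proof.
split=> [mf i|mf].
  exact: (measurableT_comp (measurable_coord i)).
apply: (@measurability _ _ _ _ _ _ (@open 'rV[R]_d)) => // _ [U oU <-].
rewrite setTI.
pose c (q : 'rV[rat]_d) : 'rV[R]_d := \row_i ratr (q 0 i).
pose D := [set p : 'rV[rat]_d * nat |
  ball (c p.1) (p.2.+1%:R^-1 : R) `<=` U].
have -> : f @^-1` U = \bigcup_(p in D)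
    [set w | forall i, `|c p.1 0 i - f w 0 i| < p.2.+1%:R^-1].
  apply/seteqP; split=> [w /= Uw|w [[q n] /= Dp H]]; last first.
    apply: Dp; split; first by rewrite invr_gt0.
    by move=> i j; rewrite (ord1 i); exact: H.
  have /nbhs_ballP[e /= e0 eU] : nbhs (f w) U by exact: open_nbhs_nbhs.
  have [n ne] : exists n, n.+1%:R^-1 < e / 2 :> R.
    have /ltr_add_invr[k] : 0 < e / 2 by rewrite divr_gt0.
    by rewrite add0r; exists k.
  have [g gP] : {g : 'I_d -> rat & forall i, `|ratr (g i) - f w 0 i| < n.+1%:R^-1}.
    apply: (@choice _ _ (fun i q => `|ratr q - f w 0 i| < n.+1%:R^-1)) => i.
    have /rat_in_itvoo[q] : f w 0 i < f w 0 i + n.+1%:R^-1.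
      by rewrite ltrDl invr_gt0.
    rewrite in_itv /= => /andP[q1 q2]; exists q.
    by rewrite gtr0_norm ?subr_gt0// ltrBlDl.
  exists (\row_i g i, n); last by move=> i /=; rewrite !mxE.
  move=> y [_ /= hy]; apply: eU; split=> // i j.
  rewrite (ord1 i); have := hy 0 j; rewrite !mxE -!ball_normE /= => hyj.
  rewrite (splitr e).
  apply: (le_lt_trans (ler_distD (ratr (g j)) _ _)); apply: ltrD.
    by rewrite distrC; exact: lt_trans (gP j) ne.
  exact: lt_trans hyj ne.
rewrite bigcup_mkcond; apply: countable_bigcupT_measurable.
  exact: countableP.
move=> p; case: ifPn => // _.
rewrite (_ : [set w | _] = \bigcap_(i in [set: 'I_d])
   ((fun w => `|c p.1 0 i - f w 0 i|) @^-1` `]-oo, p.2.+1%:R^-1[ )).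
  apply: fin_bigcap_measurable; first exact: finite_finset.
  move=> i _; rewrite -[X in measurable X]setTI.
  have mi : measurable_fun setT (fun w => `|c p.1 0 i - f w 0 i|).
    apply: measurableT_comp => //; exact: measurable_funB.
  by apply: mi => //; exact: measurable_itv.
apply/seteqP; split => [w H i _|w H i] /=; first by rewrite in_itv /=; exact: H.
by have := H i I; rewrite /= in_itv.
Qed.

End borel_rV.

Section euclidean.
Context (R : realType) (d : nat).
Implicit Types u v w : 'rV[R]_d.

Definition dotrv u v : R := \sum_(i < d) u 0 i * v 0 i.

(* The library norm on matrices is the max norm, hence this definition. *)
Definition sqnormrv u : R := dotrv u u.

Lemma dotrvC u v : dotrv u v = dotrv v u.
Proof. by apply: eq_bigr => i _; rewrite mulrC. Qed.

Lemma dotrvDl u v w : dotrv (u + v) w = dotrv u w + dotrv v w.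
Proof. by rewrite -big_split; apply: eq_bigr => i _; rewrite !mxE mulrDl. Qed.

Lemma dotrvZl a u v : dotrv (a *: u) v = a * dotrv u v.
Proof. by rewrite /dotrv mulr_sumr; apply: eq_bigr => i _; rewrite mxE mulrA. Qed.

Lemma sqnormrv_ge0 u : 0 <= sqnormrv u.
Proof. by apply: sumr_ge0 => i _; rewrite -expr2 sqr_ge0. Qed.

Lemma sqnormrv_eq0 u : sqnormrv u = 0 -> u = 0.
Proof.
move=> /psumr_eq0P h; apply/rowP => i; rewrite mxE; apply/eqP.
by rewrite -sqrf_eq0 expr2 h// => j _; rewrite -expr2 sqr_ge0.
Qed.

Lemma sqnormrvD u v : sqnormrv (u + v) = sqnormrv u + 2 * dotrv u v + sqnormrv v.
Proof.
rewrite /sqnormrv dotrvDl (dotrvC u) (dotrvC v) !dotrvDl (dotrvC v u); ring.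
Qed.

Lemma sqnormrvZ a u : sqnormrv (a *: u) = a ^+ 2 * sqnormrv u.
Proof. rewrite /sqnormrv dotrvZl (dotrvC u) dotrvZl; ring. Qed.

Lemma normr_dotrv_le u v : `|dotrv u v| <= sqnormrv u + sqnormrv v.
Proof.
have := sqnormrvD u v; have := sqnormrvD u (- 1 *: v).
rewrite sqnormrvZ [dotrv u (_ *: _)]dotrvC dotrvZl dotrvC.
have := sqnormrv_ge0 (u + v); have := sqnormrv_ge0 (u + -1 *: v).
have := sqnormrv_ge0 u; have := sqnormrv_ge0 v => *.
by rewrite ler_norml; apply/andP; split; lra.
Qed.

Lemma measurable_dotrv d0 (T : measurableType d0) (f g : T -> 'rV[R]_d) :
  measurable_fun setT f -> measurable_fun setT g ->
  measurable_fun setT (fun x => dotrv (f x) (g x)).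
Proof.
move=> /measurable_fun_rVP mf /measurable_fun_rVP mg.
rewrite /dotrv; apply: measurable_sum => i.
by apply: measurable_funM.
Qed.

Definition second_moment (mu : {measure set 'rV[R]_d -> \bar R}) : \bar R :=
  (\int[mu]_x (sqnormrv x)%:E)%E.

End euclidean.

Section L2fun.
Context d0 (T : measurableType d0) (R : realType) (P : probability T R)
  (d : nat).

Definition sqint : {pred T -> 'rV[R]_d} :=
  [pred f : T -> 'rV[R]_d | `[< measurable_fun setT f /\
    (\int[P]_w (sqnormrv (f w))%:E < +oo)%E >]].

Lemma sqintP (f : T -> 'rV[R]_d) : reflect (measurable_fun setT f /\
  P.-integrable setT (fun w => (sqnormrv (f w))%:E)) (f \in sqint).
Proof.
have e : (\int[P]_w `|(sqnormrv (f w))%:E| =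
          \int[P]_w (sqnormrv (f w))%:E)%E.
  by apply: eq_integral => w _; rewrite gee0_abs// lee_fin sqnormrv_ge0.
apply: (iffP (asboolP _)) => -[mf].
  move=> foo; split=> //; apply/integrableP; split; last by rewrite e.
  exact/measurable_EFinP/measurable_dotrv.
by move=> /integrableP[_]; rewrite e.
Qed.

Lemma integrable_dotrv (f g : T -> 'rV[R]_d) : f \in sqint -> g \in sqint ->
  P.-integrable setT (EFin \o (fun w => dotrv (f w) (g w))).
Proof.
move=> /sqintP[mf fi] /sqintP[mg gi].
apply: le_integrable (integrableD measurableT fi gi) => //.
  exact/measurable_EFinP/measurable_dotrv.
move=> w _ /=; rewrite lee_fin.
by rewrite [leRHS]ger0_norm ?addr_ge0 ?sqnormrv_ge0// normr_dotrv_le.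
Qed.

Lemma sqint_subsemimod_closed : GRing.subsemimod_closed sqint.
Proof.
split; [split|].
- apply/sqintP; split; first exact: measurable_cst.
  rewrite (_ : (fun _ => _) = cst 0%E); first exact: integrable0.
  apply/funext => w; rewrite /sqnormrv /dotrv big1// => i _.
  by rewrite !mxE mul0r.
- move=> f g fP gP; have ifg := integrable_dotrv fP gP.
  move: fP gP => /sqintP[mf fi] /sqintP[mg gi].
  apply/sqintP; split.
    apply/measurable_fun_rVP => i.
    rewrite (_ : (fun _ => _) = (fun w => f w 0 i + g w 0 i)); last first.
      by apply/funext => w; rewrite mxE.
    by apply: measurable_funD; move: i; apply/measurable_fun_rVP.
  rewrite (_ : (fun _ => _) = (fun w => (sqnormrv (f w))%:E +
     (2%:E * (EFin \o (fun w => dotrv (f w) (g w))) w) +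
     (sqnormrv (g w))%:E)%E).
    by do 2!apply: integrableD => //; exact: integrableZl.
  by apply/funext => w; rewrite /= -EFinM -!EFinD -sqnormrvD.
- move=> a f /sqintP[mf fi]; apply/sqintP; split.
    apply/measurable_fun_rVP => i.
    rewrite (_ : (fun _ => _) = (fun w => a * f w 0 i)); last first.
      by apply/funext => w; rewrite mxE.
    by apply: measurable_funM => //; move: i; apply/measurable_fun_rVP.
  rewrite (_ : (fun _ => _) =
    (fun w => (a ^+ 2)%:E * (sqnormrv (f w))%:E)%E).
    exact: integrableZl.
  by apply/funext => w; rewrite -EFinM -sqnormrvZ.
Qed.

HB.instance Definition _ :=
  GRing.isSubmodClosed.Build _ _ sqint sqint_subsemimod_closed.

Record L2fun := MkL2fun { L2fun_val :> T -> 'rV[R]_d ; _ : L2fun_val \in sqint }.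

HB.instance Definition _ := [isSub for L2fun_val].
HB.instance Definition _ := [Choice of L2fun by <:].
HB.instance Definition _ := [SubChoice_isSubLmodule of L2fun by <:].

Implicit Types f g h : L2fun.

Lemma L2fun_measurable f : measurable_fun setT (f : T -> 'rV[R]_d).
Proof. by have /sqintP[] := valP f. Qed.

HB.instance Definition _ f :=
  isMeasurableFun.Build _ _ T 'rV[R]_d f (L2fun_measurable f).

Definition dotL2fun f g : R := fine 'E_P[fun w => dotrv (f w) (g w)].

Lemma dotL2funE f g :
  dotL2fun f g = (\int[P]_(w in setT) dotrv (f w) (g w))%R.
Proof. by rewrite /dotL2fun unlock. Qed.

Lemma dotL2funC f g : dotL2fun f g = dotL2fun g f.
Proof. by rewrite !dotL2funE; apply: eq_Rintegral => w _; rewrite dotrvC. Qed.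

Lemma dotL2funDl f g h : dotL2fun (f + g) h = dotL2fun f h + dotL2fun g h.
Proof.
rewrite !dotL2funE -RintegralD//; do ?exact: integrable_dotrv (valP _) (valP _).
by apply: eq_Rintegral => w _; rewrite -dotrvDl.
Qed.

Lemma dotL2funZl a f g : dotL2fun (a *: f) g = a * dotL2fun f g.
Proof.
rewrite !dotL2funE -RintegralZl//; last exact: integrable_dotrv (valP _) (valP _).
by apply: eq_Rintegral => w _; rewrite -dotrvZl.
Qed.

Lemma dotL2fun_ge0 f : 0 <= dotL2fun f f.
Proof. by rewrite dotL2funE Rintegral_ge0// => w _; exact: sqnormrv_ge0. Qed.

Definition ae0 : {pred L2fun} :=
  [pred f : L2fun | `[< {ae P, forall w, f w = 0 } >]].

Lemma ae0_subsemimod_closed : GRing.subsemimod_closed ae0.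
Proof.
split; [split|].
- by apply/asboolP; apply: nearW => w.
- move=> f g /asboolP f0 /asboolP g0; apply/asboolP.
  apply: filterS2 f0 g0 => w f0 g0.
  by rewrite [LHS](_ : _ = f w + g w)// f0 g0 addr0.
- move=> a f /asboolP f0; apply/asboolP; apply: filterS f0 => w f0.
  by rewrite [LHS](_ : _ = a *: f w)// f0 scaler0.
Qed.

HB.instance Definition _ :=
  GRing.isSubmodClosed.Build _ _ ae0 ae0_subsemimod_closed.

Lemma dotL2fun_eq0 f : dotL2fun f f = 0 -> f \in ae0.
Proof.
have mf := measurable_dotrv (L2fun_measurable f) (L2fun_measurable f).
move=> f0; apply/asboolP.
have : (\int[P]_w `|(sqnormrv (f w))%:E| = 0)%E.
  have fi := integrable_dotrv (valP f) (valP f).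
  rewrite -[RHS]/(0%:E) -f0 dotL2funE /Rintegral fineK; last first.
    exact: integrable_fin_num.
  by apply: eq_integral => w _; rewrite gee0_abs// lee_fin sqnormrv_ge0.
move=> /ae_eq_integral_abs-/(_ measurableT).
have : measurable_fun setT (fun w => (sqnormrv (f w))%:E).
  exact/measurable_EFinP.
move=> /[swap] /[apply]; apply: filterS => w /(_ I) [].
exact: sqnormrv_eq0.
Qed.

Lemma ae0_dotL2fun f g : f \in ae0 -> dotL2fun f g = 0.
Proof.
move=> /asboolP f0; rewrite dotL2funE /Rintegral.
rewrite (@ae_eq_integral _ _ _ P setT (cst 0%E))//.
- by rewrite integral0.
- exact/measurable_EFinP/measurable_dotrv/L2fun_measurable/L2fun_measurable.
- apply: filterS f0 => w -> _; congr EFin.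
  by rewrite /dotrv big1// => i _; rewrite mxE mul0r.
Qed.

End L2fun.

(* H = L^2(T, P; R^d), as classes of square-integrable random vectors modulo
   a.e. equality, with inner product <x, y> = E[x . y]. *)
Section L2.
Context d0 (T : measurableType d0) (R : realType) (P : probability T R)
  (d : nat).

Definition L2 : Type := Quotient.quot (@ae0 d0 T R P d).

HB.instance Definition _ := GRing.Zmodule.on L2.
HB.instance Definition _ := EqQuotient.on L2.

Implicit Types (x y z : L2) (f g h : L2fun P d).

Local Notation pi := (\pi_L2%qT).

Lemma piL2_eq f g : (pi f = pi g) <-> (f - g \in @ae0 d0 T R P d).
Proof.
by rewrite Quotient.idealrBE; split=> [/eqP|/eqP].
Qed.

Lemma piL2_surj x : exists f, x = pi f.
Proof. by exists (repr x); rewrite reprK. Qed.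

Lemma piL2D f g : pi (f + g) = pi f + pi g.
Proof. exact: Quotient.pi_add. Qed.

Definition L2scale (a : R) x : L2 := pi (a *: repr x).

Lemma L2scaleE a f : L2scale a (pi f) = pi (a *: f).
Proof.
apply/piL2_eq; rewrite -scalerBr rpredZ//; apply/piL2_eq.
by rewrite reprK.
Qed.

Let L2scaleA a b x : L2scale a (L2scale b x) = L2scale (a * b) x.
Proof. by have [f ->] := piL2_surj x; rewrite !L2scaleE scalerA. Qed.

Let L2scale1 : left_id 1 L2scale.
Proof. by move=> x; have [f ->] := piL2_surj x; rewrite !L2scaleE scale1r. Qed.

Let L2scaleDr : right_distributive L2scale +%R.
Proof.
move=> a x y; have [f ->] := piL2_surj x; have [g ->] := piL2_surj y.
by rewrite -piL2D !L2scaleE scalerDr piL2D.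
Qed.

Let L2scaleDl x : {morph L2scale^~ x : a b / a + b}.
Proof.
move=> a b; have [f ->] := piL2_surj x.
by rewrite !L2scaleE scalerDl piL2D.
Qed.

HB.instance Definition _ :=
  GRing.Zmodule_isLmodule.Build R L2 L2scaleA L2scale1 L2scaleDr L2scaleDl.

Lemma piL2Z a f : pi (a *: f) = a *: pi f.
Proof. by rewrite -L2scaleE. Qed.

Definition inner x y : R := dotL2fun (repr x) (repr y).

Lemma innerE f g : inner (pi f) (pi g) = dotL2fun f g.
Proof.
have key h h' k : pi h = pi h' -> dotL2fun h k = dotL2fun h' k.
  move=> /piL2_eq/ae0_dotL2fun-/(_ k) e.
  by rewrite -[h](subrK h') dotL2funDl e add0r.
rewrite /inner (key _ f) ?reprK// dotL2funC (key _ g) ?reprK//.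
exact: dotL2funC.
Qed.

Lemma innerC x y : inner x y = inner y x.
Proof. exact: dotL2funC. Qed.

Lemma innerDl x y z : inner (x + y) z = inner x z + inner y z.
Proof.
have [f ->] := piL2_surj x; have [g ->] := piL2_surj y.
by have [h ->] := piL2_surj z; rewrite -piL2D !innerE dotL2funDl.
Qed.

Lemma innerZl a x y : inner (a *: x) y = a * inner x y.
Proof.
have [f ->] := piL2_surj x; have [g ->] := piL2_surj y.
by rewrite -piL2Z !innerE dotL2funZl.
Qed.

Lemma inner_ge0 x : 0 <= inner x x.
Proof. exact: dotL2fun_ge0. Qed.

Lemma inner_eq0 x : inner x x = 0 -> x = 0.
Proof.
have [f ->] := piL2_surj x; rewrite innerE => /dotL2fun_eq0 f0.
have -> : 0 = pi 0 by apply: (addrI (pi 0)); rewrite -piL2D !addr0.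
by apply/piL2_eq; rewrite subr0.
Qed.

Definition L2norm x : R := Num.sqrt (inner x x).

Lemma innerDD x y : inner (x + y) (x + y) = inner x x + 2 * inner x y + inner y y.
Proof.
rewrite innerDl (innerC x (x + y)) (innerC y (x + y)) !innerDl (innerC y x); ring.
Qed.

Lemma inner_cauchy_schwarz x y : inner x y <= L2norm x * L2norm y.
Proof.
have [x0|x0] := eqVneq (inner x x) 0.
  rewrite (inner_eq0 x0) -(scale0r 0) innerZl mul0r.
  by rewrite mulr_ge0// sqrtr_ge0.
have xgt : 0 < inner x x by rewrite lt_neqAle eq_sym x0 inner_ge0.
rewrite /L2norm -sqrtrM ?inner_ge0//.
apply: (le_trans (ler_norm _)); rewrite -sqrtr_sqr ler_wsqrtr//.
have := inner_ge0 (inner x y *: x + (- inner x x) *: y).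
rewrite innerDD !innerZl [inner x (_ *: y)]innerC [inner x (_ *: x)]innerC.
rewrite [inner y (_ *: y)]innerC !innerZl (innerC y x).
set a := inner x y; set b := inner x x; set c := inner y y => h.
have : 0 <= b * (b * c - a ^+ 2) by apply: le_trans h _; lra.
by rewrite pmulr_rge0// subr_ge0.
Qed.

Let L2normD x y : L2norm (x + y) <= L2norm x + L2norm y.
Proof.
rewrite -[leRHS]ger0_norm ?addr_ge0 ?sqrtr_ge0// -sqrtr_sqr ler_wsqrtr//.
rewrite innerDD sqrrD !sqr_sqrtr ?inner_ge0// lerD2r lerD2l.
by rewrite -[leRHS]mulr_natl ler_pM2l// inner_cauchy_schwarz.
Qed.

Let L2normZ a x : L2norm (a *: x) = `|a| * L2norm x.
Proof.
rewrite /L2norm innerZl innerC innerZl mulrA -expr2 sqrtrM ?sqr_ge0//.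
by rewrite sqrtr_sqr.
Qed.

Let L2norm_eq0 x : L2norm x = 0 -> x = 0.
Proof.
move=> /eqP; rewrite sqrtr_eq0 => h; apply: inner_eq0.
by apply/eqP; rewrite eq_le h inner_ge0.
Qed.

HB.instance Definition _ :=
  Lmodule_isNormed.Build R L2 L2normD L2normZ L2norm_eq0.

(* Two representatives of X are a.e. equal, so the choice made by [repr] does
   not affect the law. *)
Definition law (X : L2) : probability 'rV[R]_d R :=
  distribution P (L2fun_val (repr X)).

(* Riesz representative of the Frechet derivative 'd f X, chosen by [xget]. *)
Definition gradient (f : L2 -> R^o) (X : L2) : L2 :=
  xget 0 [set g : L2 | forall h : L2, 'd f X h = inner g h].

End L2.

Section wasserstein.
Context (R : realType) (d : nat).
Implicit Types mu nu : probability 'rV[R]_d R.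

Definition coupling mu nu : set (probability ('rV[R]_d * 'rV[R]_d)%type R) :=
  [set gamma | forall A, measurable A ->
     gamma (A `*` setT) = mu A /\ gamma (setT `*` A) = nu A].

(* The square of the Wasserstein distance. *)
Definition W2sq mu nu : \bar R :=
  ereal_inf [set (\int[gamma]_z (sqnormrv (z.1 - z.2))%:E)%E
            | gamma in coupling mu nu].

End wasserstein.

Section probability_space.
Context d0 (T : measurableType d0) (R : realType).

(* The sigma-algebra is the Borel one for some Polish topology; [phi] transports
   the topology of the Polish space E to T. *)
Definition standard_borel : Prop :=
  exists (E : completePseudoMetricType R) (phi : T -> E),
    [/\ hausdorff_space E, @second_countable E, bijective phi &
        forall A : set T, measurable A <-> <<s @open E >> (phi @` A)].

Definition atomless (P : probability T R) : Prop :=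
  forall A, measurable A -> (0 < P A)%E ->
  exists B, [/\ measurable B, B `<=` A, (0 < P B)%E & (P B < P A)%E].

End probability_space.

Section functionals.
Context d0 (T : measurableType d0) (R : realType) (P : probability T R)
  (d : nat) (nu : probability 'rV[R]_d R).

(* Both W2sq (law X) nu, for nu of finite second moment, and the supremum below,
   for 0 < delta < 1, are finite, so [fine] and the real [sup] lose nothing. *)
Definition U (X : L2 P d) : R^o := fine (W2sq (law X) nu).

Definition Udelta (delta : R) (X : L2 P d) : R^o :=
  sup [set U X' - delta^-1 * `|X - X'| ^+ 2 | X' in [set: L2 P d]].

End functionals.

Arguments U {d0 T R} P {d} nu X.
Arguments Udelta {d0 T R} P {d} nu delta X.

(* Main.v *)
(* Only two properties of U matter. First, U - |.|^2 is concave on H: lifting an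
   (almost) optimal coupling of the law of (1 - t) X1 + t X2 with nu to a
   coupling of P with nu gives couplings of the laws of X1 and X2 with nu, and
   the parallelogram-type identity for |(1 - t) x1 + t x2 - y|^2 is integrated.
   The lift is made without disintegration, by first discretizing R^d on a fine
   grid. Second, H is complete.

   For delta < 1 the function U - |X - .|^2 / delta is then strongly concave, so
   its maximizing sequences converge to some X*; comparing U_delta at X and
   X + h shows that p = (2 / delta) (X* - X) is the gradient of U_delta at X,
   and the maximality of X* shows that U(Y) <= m + <p, Y - X*> + |Y - X*|^2,
   i.e. p is a supergradient of U at X*. As delta -> 0 one has X*_delta -> X0,
   and supergradients of a semiconcave function converge strongly to its
   gradient at a point of Frechet differentiability. *)
Require Import Defs.
From HB Require Import structures.
From mathcomp Require Import all_boot all_order all_algebra.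
From mathcomp Require Import all_classical all_reals all_analysis.
From mathcomp Require Import measurable_realfun.
From mathcomp Require Import ring lra.
Import Order.TTheory GRing.Theory Num.Theory.
Import numFieldNormedType.Exports.
Local Open Scope classical_set_scope.
Local Open Scope ring_scope.

Set Implicit Arguments.
Unset Strict Implicit.
Unset Printing Implicit Defensive.

(** * Couplings over a countable partition *)

Lemma nneseries_measure_fibers d (T : measurableType d) (R : realType)
    (m : {measure set T -> \bar R}) (f : T -> nat) (A : set T) :
  (forall k, measurable (f @^-1` [set k])) -> measurable A ->
  (\sum_(0 <= k <oo) m (A `&` f @^-1` [set k]))%E = m A.
Proof.
move=> mf mA.
rewrite -measure_semi_bigcup.
- congr (m _); apply/seteqP; split => [w [k _ []]//|w Aw].
  by exists (f w).
- by move=> k; exact: measurableI.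
- by move=> i j _ _ [w [[_ /= <-] [_ /= <-]]].
- by apply: bigcupT_measurable => k; exact: measurableI.
Qed.

Section glue.
Context d1 d2 (T1 : measurableType d1) (T2 : measurableType d2) (R : realType).
Variables (m1 : probability T1 R) (m2 : probability T2 R).
Variables (q : T1 -> nat) (r : T2 -> nat).
Hypothesis mq : forall k, measurable (q @^-1` [set k]).
Hypothesis mr : forall k, measurable (r @^-1` [set k]).
Hypothesis qr : forall k, m1 (q @^-1` [set k]) = m2 (r @^-1` [set k]).
Local Open Scope ereal_scope.

Let q_fin k : m1 (q @^-1` [set k]) < +oo.
Proof. by rewrite -ge0_fin_numE// fin_num_measure. Qed.

Let r_fin k : m2 (r @^-1` [set k]) < +oo.
Proof. by rewrite -ge0_fin_numE// fin_num_measure. Qed.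

Let piece1 k : {finite_measure set T1 -> \bar R} := mfrestr (mq k) (q_fin k).
Let piece2 k : {finite_measure set T2 -> \bar R} := mfrestr (mr k) (r_fin k).

Let weight_ge0 k : (0 <= (fine (m1 (q @^-1` [set k])))^-1)%R.
Proof. by rewrite invr_ge0 fine_ge0. Qed.

(** A cell of mass zero gets the weight [0^-1 = 0] and its piece vanishes. Nothing is lost, since
    [qr] makes such a cell null for both [m1] and [m2]. *)
Let piece k : {measure set (T1 * T2) -> \bar R} :=
  mscale (NngNum (weight_ge0 k)) (piece1 k \x piece2 k).

Let pieceE k A B : measurable A -> measurable B ->
  piece k (A `*` B) = ((fine (m1 (q @^-1` [set k])))^-1)%:E *
   (m1 (A `&` q @^-1` [set k]) * m2 (B `&` r @^-1` [set k])).
Proof. by move=> mA mB; rewrite /piece /= /mscale /= product_measure1E. Qed.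

Let glued : set (T1 * T2) -> \bar R := mseries piece 0.

Let fiber0 k A : measurable A -> fine (m1 (q @^-1` [set k])) = 0%R ->
  m1 (A `&` q @^-1` [set k]) = 0.
Proof.
move=> mA q0; apply: (subset_measure0 _ (mq k) (@subIsetr _ _ _)).
  exact: measurableI.
by rewrite -[LHS]fineK ?q0// fin_num_measure.
Qed.

Let fiber0r k A : measurable A -> fine (m1 (q @^-1` [set k])) = 0%R ->
  m2 (A `&` r @^-1` [set k]) = 0.
Proof.
move=> mA q0.
have r0 : m2 (r @^-1` [set k]) = 0.
  by rewrite -qr -[LHS]fineK ?q0// fin_num_measure.
by apply: (subset_measure0 _ (mr k) (@subIsetr _ _ _) r0); exact: measurableI.
Qed.

Let weightK k : fine (m1 (q @^-1` [set k])) != 0%R ->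
  ((fine (m1 (q @^-1` [set k])))^-1)%:E * m1 (q @^-1` [set k]) = 1.
Proof.
by move=> /mulVf q0; rewrite -[in RHS]q0 EFinM fineK// fin_num_measure.
Qed.

Let glued1 A : measurable A -> glued (A `*` setT) = m1 A.
Proof.
move=> mA; rewrite -(nneseries_measure_fibers m1 mq mA).
apply: eq_eseriesr => k _; rewrite pieceE//.
have [q0|q0] := eqVneq (fine (m1 (q @^-1` [set k]))) 0%R.
  by rewrite (fiber0 mA q0) mul0e mule0; exact/esym/fiber0.
rewrite setTI -qr muleCA (weightK q0) mule1; apply: erefl.
Qed.

Let glued2 B : measurable B -> glued (setT `*` B) = m2 B.
Proof.
move=> mB; rewrite -(nneseries_measure_fibers m2 mr mB).
apply: eq_eseriesr => k _; rewrite pieceE//.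
have [q0|q0] := eqVneq (fine (m1 (q @^-1` [set k]))) 0%R.
  by rewrite (fiber0r mB q0) !mule0; exact/esym/fiber0r.
rewrite setTI muleA (weightK q0) mul1e; apply: erefl.
Qed.

Let measurable_neq : measurable [set z : T1 * T2 | q z.1 <> r z.2].
Proof.
rewrite (_ : [set z | _] =
    ~` \bigcup_k ((q @^-1` [set k]) `*` (r @^-1` [set k]))).
  apply: measurableC; apply: bigcupT_measurable => k; exact: measurableX.
apply/seteqP; split => z /= H.
  by move=> [k _ [/= e1 e2]]; apply: H; rewrite e1 e2.
by move=> e; apply: H; exists (q z.1).
Qed.

(** The k-th piece lives on the rectangle where both labels equal k. Mismatched points avoid that
    rectangle, so two slabs that are null for the piece cover them. *)
Let glued_neq : glued [set z : T1 * T2 | q z.1 <> r z.2] = 0.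
Proof.
rewrite /glued /mseries eseries0// => k _ _.
apply/eqP; rewrite -measure_le0.
have mqC := measurableC (mq k); have mrC := measurableC (mr k).
apply: (@le_trans _ _ (piece k ((~` (q @^-1` [set k])) `*` setT
    `|` setT `*` ~` (r @^-1` [set k])))).
  apply: le_measure; rewrite ?inE//.
    by apply: measurableU; exact: measurableX.
  move=> [x y] /= H; have [qx|qx] := eqVneq (q x) k; [right|left]; split => //=.
    by move=> ry; apply: H; rewrite qx ry.
  exact/eqP.
apply: (@le_trans _ _ (piece k ((~` (q @^-1` [set k])) `*` setT)
    + piece k (setT `*` ~` (r @^-1` [set k])))).
  by apply: measureU2; exact: measurableX.
by rewrite !pieceE// !setICl !measure0 mul0e !mule0 adde0.
Qed.

HB.instance Definition _ := Measure.on glued.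

Let glued_setT : glued setT = 1.
Proof. by rewrite -setXTT glued1// probability_setT. Qed.

HB.instance Definition _ :=
  @Measure_isProbability.Build _ _ _ glued glued_setT.

(* The two factors are made independent conditionally on the common value of
   [q] and [r], i.e. the coupling is the sum over k of
   m1|_{q = k} (x) m2|_{r = k} / m1(q = k). *)
Lemma coupling_over_nat : exists pi : probability (T1 * T2)%type R,
  [/\ forall A, measurable A -> pi (A `*` setT) = m1 A,
      forall B, measurable B -> pi (setT `*` B) = m2 B &
      {ae pi, forall z, q z.1 = r z.2}].
Proof.
exists glued; split=> //.
exists [set z : T1 * T2 | q z.1 <> r z.2]; split=> //.
Qed.

End glue.

(** * Euclidean space and grids *)

Section euclidean_extra.
Context (R : realType) (d : nat).
Implicit Types x y : 'rV[R]_d.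

(** Expand [|s x - y|^2 >= 0] and divide by s. With small s, a small perturbation y costs only a
    factor close to 1 on the main term. *)
Lemma sqnormrvD_young (s : R) x y : 0 < s ->
  sqnormrv (x + y) <= (1 + s) * sqnormrv x + (1 + s^-1) * sqnormrv y.
Proof.
move=> s0; rewrite sqnormrvD.
have := sqnormrv_ge0 (s *: x - y).
rewrite sqnormrvD -scaleN1r dotrvZl (dotrvC x) dotrvZl !sqnormrvZ.
rewrite (dotrvC y) => h.
have : 0 <= s^-1 * (s ^+ 2 * sqnormrv x + 2 * (s * (-1 * dotrv x y)) +
    (-1) ^+ 2 * sqnormrv y) by rewrite mulr_ge0// invr_ge0 ltW.
rewrite (_ : s^-1 * _ = s * sqnormrv x - 2 * dotrv x y + s^-1 * sqnormrv y).
  lra.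
by field; rewrite gt_eqF.
Qed.

Lemma sqnormrvN x : sqnormrv (- x) = sqnormrv x.
Proof. by rewrite -scaleN1r sqnormrvZ sqrrN expr1n mul1r. Qed.

(** The last term does not involve y; this is why the same defect appears whatever the coupling with
    [nu]. *)
Lemma sqnormrv_convex (t : R) x1 x2 y :
  (1 - t) * sqnormrv (x1 - y) + t * sqnormrv (x2 - y) =
  sqnormrv ((1 - t) *: x1 + t *: x2 - y) + t * (1 - t) * sqnormrv (x1 - x2).
Proof.
rewrite /sqnormrv /dotrv !mulr_sumr -!big_split /=; apply: eq_bigr => i _.
by rewrite !mxE; ring.
Qed.

(** The cells are half-open cubes of side [1 / a], numbered through the countability of integer
    vectors. *)
Lemma grid_cells (s : R) : 0 < s -> exists q : 'rV[R]_d -> nat,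
  (forall k, measurable (q @^-1` [set k])) /\
  forall x y, q x = q y -> sqnormrv (x - y) <= s.
Proof.
(* The squared diameter of a cube is at most [d / a^2], and this [a] gives [d <= s * a^2], also when
   d = 0. *)
move=> s0; pose a : R := 1 + d%:R / s.
have a1 : 1 <= a by rewrite lerDl divr_ge0// ltW.
have a0 : 0 < a by exact: lt_le_trans a1.
pose c x : 'rV[int]_d := \row_i Num.floor (a * x 0 i).
exists (fun x => pickle (c x)); split => [k|x y /(pcan_inj pickleK) exy].
  (* A number that encodes no integer vector has an empty cell. *)
  have [[v vk]|nk] := pselect (exists v : 'rV[int]_d, pickle v = k); last first.
    rewrite (_ : _ @^-1` _ = set0)//; apply/seteqP; split => // x /= xk.
    by apply: nk; exists (c x).
  rewrite (_ : _ @^-1` _ = \bigcap_(i in [set: 'I_d])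
     ((fun x => a * x 0 i) @^-1` `[(v 0 i)%:~R, (v 0 i + 1)%:~R[ )).
    apply: fin_bigcap_measurable; first exact: finite_finset.
    move=> i _; rewrite -[X in measurable X]setTI.
    have : measurable_fun setT (fun x => a * x 0 i).
      by apply: measurable_funM => //; exact: measurable_coord.
    by apply => //; exact: measurable_itv.
  apply/seteqP; split => x /=.
    rewrite -vk => /(pcan_inj pickleK) <- i _ /=.
    by rewrite in_itv /= mxE floor_itv.
  move=> H; rewrite -vk; congr pickle; apply/rowP => i; rewrite mxE.
  by apply: floor_def; have := H i I; rewrite /= in_itv.
have h i : (x 0 i - y 0 i) ^+ 2 <= (a ^+ 2)^-1.
  have := congr1 (fun m : 'rV[int]_d => m 0 i) exy; rewrite !mxE => e.
  have := floor_itv (a * x 0 i); have := floor_itv (a * y 0 i).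
  rewrite e intrD1 => /andP[? ?] /andP[? ?].
  rewrite -[leRHS]mul1r ler_pdivlMr ?exprn_gt0// -exprMn.
  rewrite -[leRHS](expr1n _ 2) -ler_sqrt ?ler01// !sqrtr_sqr normr1.
  by rewrite ler_norml; apply/andP; split; lra.
apply: (@le_trans _ _ (\sum_(i < d) (a ^+ 2)^-1)).
  by apply: ler_sum => i _; rewrite !mxE -expr2.
rewrite sumr_const card_ord -mulr_natl ler_pdivrMr ?exprn_gt0//.
have -> : s * a ^+ 2 = d%:R + s + s * (d%:R / s) ^+ 2 + d%:R.
  by rewrite /a; field; rewrite gt_eqF.
have := mulr_ge0 (ltW s0) (sqr_ge0 (d%:R / s)); have := ler0n R d; lra.
Qed.

End euclidean_extra.

(** * Integrals that depend on one marginal only *)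

Lemma ge0_integral_marginal1 d1 d2 (T1 : measurableType d1)
    (T2 : measurableType d2) (R : realType)
    (m : {measure set (T1 * T2) -> \bar R}) (m1 : {measure set T1 -> \bar R})
    (f : T1 -> \bar R) :
  (forall A, measurable A -> m (A `*` setT) = m1 A) ->
  measurable_fun setT f -> (forall x, 0 <= f x)%E ->
  (\int[m]_z f z.1 = \int[m1]_x f x)%E.
Proof.
move=> mm1 mf f0.
rewrite -(@ge0_integral_pushforward _ _ _ _ _ fst _ m setT f)//.
apply: eq_measure_integral => A mA _ /=.
by rewrite -mm1// /pushforward setXT.
Qed.

Lemma ge0_integral_marginal2 d1 d2 (T1 : measurableType d1)
    (T2 : measurableType d2) (R : realType)
    (m : {measure set (T1 * T2) -> \bar R}) (m2 : {measure set T2 -> \bar R})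
    (f : T2 -> \bar R) :
  (forall A, measurable A -> m (setT `*` A) = m2 A) ->
  measurable_fun setT f -> (forall x, 0 <= f x)%E ->
  (\int[m]_z f z.2 = \int[m2]_x f x)%E.
Proof.
move=> mm1 mf f0.
rewrite -(@ge0_integral_pushforward _ _ _ _ _ snd _ m setT f)//.
apply: eq_measure_integral => A mA _ /=.
by rewrite -mm1// /pushforward setTX.
Qed.

(** * The Wasserstein cost *)

Section transport.
Context (R : realType) (d : nat).
Implicit Types mu nu : probability 'rV[R]_d R.

Lemma measurable_rVB d0 (T : measurableType d0) (f g : T -> 'rV[R]_d) :
  measurable_fun setT f -> measurable_fun setT g ->
  measurable_fun setT (fun x => f x - g x).
Proof.
move=> /measurable_fun_rVP mf /measurable_fun_rVP mg.
apply/measurable_fun_rVP => i.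
rewrite (_ : (fun _ => _) = (fun x => f x 0 i - g x 0 i)).
  exact: measurable_funB.
by apply/funext => x; rewrite !mxE.
Qed.

Lemma measurable_sqnormrvB d0 (T : measurableType d0) (f g : T -> 'rV[R]_d) :
  measurable_fun setT f -> measurable_fun setT g ->
  measurable_fun setT (fun x => (sqnormrv (f x - g x))%:E).
Proof.
move=> mf mg.
by apply/measurable_EFinP/measurable_dotrv; exact: measurable_rVB.
Qed.

Lemma W2sq_ge0 mu nu : (0 <= W2sq mu nu)%E.
Proof.
apply: le_ereal_inf_tmp => _ [g _ <-].
by apply: integral_ge0 => z _; rewrite lee_fin sqnormrv_ge0.
Qed.

(** The joint law of [a] and [b] under [m] is a coupling. Hence any probability space carrying both
    random vectors bounds the cost. *)
Lemma W2sq_le d0 (S : measurableType d0) (m : probability S R) mu nu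
    (a b : S -> 'rV[R]_d) :
  measurable_fun setT a -> measurable_fun setT b ->
  (forall A, measurable A -> mu A = m (a @^-1` A)) ->
  (forall A, measurable A -> nu A = m (b @^-1` A)) ->
  (W2sq mu nu <= \int[m]_z (sqnormrv (a z - b z))%:E)%E.
Proof.
move=> ma mb mua nub.
have mab : measurable_fun setT (fun z => (a z, b z)).
  exact: measurable_fun_pair.
pose ab : {mfun S >-> ('rV[R]_d * 'rV[R]_d)%type} :=
  HB.pack (fun z => (a z, b z)) (isMeasurableFun.Build _ _ _ _ _ mab).
have cab : coupling mu nu (distribution m ab).
  by move=> A mA; rewrite mua// nub//; split; congr (m _);
    apply/seteqP; split => z //= -[].
apply: (@le_trans _ _
    (\int[distribution m ab]_z (sqnormrv (z.1 - z.2))%:E)%E).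
  by apply: ereal_inf_lbound; exists (distribution m ab).
rewrite ge0_integral_pushforward//.
- exact: measurable_sqnormrvB measurable_fst measurable_snd.
- by move=> z _; rewrite lee_fin sqnormrv_ge0.
Qed.

(** The product coupling has finite cost, because [|x - y|^2 <= 2 |x|^2 + 2 |y|^2]. *)
Lemma W2sq_fin_num mu nu :
  (second_moment mu < +oo)%E -> (second_moment nu < +oo)%E ->
  W2sq mu nu \is a fin_num.
Proof.
move=> mu2 nu2; rewrite ge0_fin_numE ?W2sq_ge0//.
pose m : probability ('rV[R]_d * 'rV[R]_d)%type R := (mu \x nu)%E.
have mm1 A : measurable A -> m (A `*` setT) = mu A.
  by move=> mA; rewrite /m/= product_measure1E//= probability_setT mule1.
have mm2 A : measurable A -> m (setT `*` A) = nu A.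
  by move=> mA; rewrite /m/= product_measure1E//= probability_setT mul1e.
have ms : measurable_fun setT (fun x : 'rV[R]_d => (sqnormrv x)%:E).
  by apply/measurable_EFinP/measurable_dotrv; exact: measurable_id.
have s0 (x : 'rV[R]_d) : (0 <= (sqnormrv x)%:E)%E.
  by rewrite lee_fin sqnormrv_ge0.
have ms1 : measurable_fun setT
    (fun z : 'rV[R]_d * 'rV[R]_d => (sqnormrv z.1)%:E).
  exact: (measurableT_comp ms measurable_fst).
have ms2 : measurable_fun setT
    (fun z : 'rV[R]_d * 'rV[R]_d => (sqnormrv z.2)%:E).
  exact: (measurableT_comp ms measurable_snd).
apply: (@le_lt_trans _ _ (\int[m]_z (sqnormrv (z.1 - z.2))%:E)%E).
  apply: (@W2sq_le _ _ m mu nu fst snd) => // A mA.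
    by rewrite -mm1//; congr (m _); rewrite setXT.
  by rewrite -mm2//; congr (m _); rewrite setTX.
apply: (@le_lt_trans _ _ (\int[m]_z (2%:E * (sqnormrv z.1)%:E +
    2%:E * (sqnormrv z.2)%:E))%E).
  apply: ge0_le_integral => //.
  - exact: measurable_sqnormrvB measurable_fst measurable_snd.
  - by apply: emeasurable_funD; exact: measurable_funeM.
  - move=> z _; rewrite -!EFinM -EFinD lee_fin.
    have := sqnormrvD_young z.1 (- z.2) (@ltr01 R).
    by rewrite sqnormrvN invr1.
have s20 (x : 'rV[R]_d) : (0 <= 2%:E * (sqnormrv x)%:E)%E.
  by rewrite -EFinM lee_fin mulr_ge0// sqnormrv_ge0.
rewrite (ge0_integralD m measurableT (fun z _ => s20 z.1) _
  (fun z _ => s20 z.2))//; [|exact: measurable_funeM..].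
rewrite !ge0_integralZl//.
rewrite (ge0_integral_marginal1 mm1 ms)// (ge0_integral_marginal2 mm2 ms)//.
by rewrite lte_add_pinfty// lte_mul_pinfty// /second_moment integral_ge0.
Qed.

End transport.

(** * Semiconcavity of U *)

Section semiconcavity.
Context d0 (T : measurableType d0) (R : realType) (P : probability T R)
  (d : nat).
Implicit Types (f g : L2fun P d) (x y : L2 P d).

Let pi f : L2 P d := (\pi_(L2 P d) f)%qT.

(** The chosen representative agrees with [f] almost everywhere, so the indicators of the two
    preimages have the same integral. *)
Lemma lawE f (A : set 'rV[R]_d) : measurable A -> law (pi f) A = P (f @^-1` A).
Proof.
move=> mA; rewrite /law /distribution /pushforward.
have /piL2_eq/asboolP fae : pi (repr (pi f)) = pi f by rewrite /pi reprK.
have mfA g : measurable (g @^-1` A).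
  by rewrite -[X in measurable X]setTI; exact: L2fun_measurable.
have Pint g : P (g @^-1` A) = (\int[P]_w (\1_(g @^-1` A) w)%:E)%E.
  by rewrite integral_indic// setIT.
rewrite (Pint f) [LHS](Pint (repr (pi f))); apply: ae_eq_integral => //.
- by apply/measurable_EFinP; exact: measurable_indic.
- by apply/measurable_EFinP; exact: measurable_indic.
apply: filterS fae => w /subr0_eq fw _; rewrite !indicE.
have -> // : (w \in repr (pi f) @^-1` A) = (w \in f @^-1` A).
by apply/idP/idP; rewrite !inE /=
  (fw : L2fun_val (repr (pi f)) w = L2fun_val f w).
Qed.

Lemma integral_sqnormrv_L2fun f :
  (\int[P]_w (sqnormrv (f w))%:E = (dotL2fun f f)%:E)%E.
Proof.
rewrite dotL2funE /Rintegral fineK//; apply: integrable_fin_num => //.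
exact: (integrable_dotrv (valP f) (valP f)).
Qed.

Variable nu : probability 'rV[R]_d R.
Hypothesis nu2 : (second_moment nu < +oo)%E.

Let W2sq_law_fin_num x : W2sq (law x) nu \is a fin_num.
Proof.
apply: W2sq_fin_num => //; have [f ->] := piL2_surj x; rewrite /second_moment.
have ms : measurable_fun setT (fun x : 'rV[R]_d => (sqnormrv x)%:E).
  by apply/measurable_EFinP/measurable_dotrv; exact: measurable_id.
rewrite (eq_measure_integral (pushforward P f)); last first.
  by move=> A mA _; exact: lawE.
rewrite (ge0_integral_pushforward (L2fun_measurable f))//.
  by rewrite preimage_setT [ltLHS]integral_sqnormrv_L2fun ltry.
by move=> z _; rewrite lee_fin sqnormrv_ge0.
Qed.

(* A coupling of the law of (1 - t) f1 + t f2 with nu is lifted, up to the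
   mesh of a grid, to a coupling of P with nu; it then couples the laws of f1
   and f2 with nu as well. *)
Lemma semiconcave_coupling f1 f2 t (gamma : probability _ R) c s :
  0 <= t <= 1 -> 0 < s ->
  coupling (law (pi ((1 - t) *: f1 + t *: f2))) nu gamma ->
  (\int[gamma]_z (sqnormrv (z.1 - z.2))%:E = c%:E)%E ->
  (1 - t) * U P nu (pi f1) + t * U P nu (pi f2) <=
  (1 + s) * c + (s ^+ 2 + s) + t * (1 - t) * dotL2fun (f1 - f2) (f1 - f2).
Proof.
move=> /andP[t0 t1] s0 gc cE; set f := (1 - t) *: f1 + t *: f2.
have [q [mq qs]] := @grid_cells R d (s ^+ 2) (exprn_gt0 2 s0).
have mqf k : measurable ((q \o f) @^-1` [set k]).
  rewrite comp_preimage -[X in measurable X]setTI.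
  exact: (L2fun_measurable f).
have mq1 k : measurable ((fun z : 'rV[R]_d * 'rV[R]_d => q z.1) @^-1` [set k]).
  rewrite (_ : _ @^-1` _ = (q @^-1` [set k]) `*` setT).
    exact: measurableX.
  by rewrite setXT.
have qE k : P ((q \o f) @^-1` [set k]) =
    gamma ((fun z => q z.1) @^-1` [set k]).
  have [+ _] := gc _ (mq k); rewrite lawE// setXT => ->//.
(* Under [pi0], a triple (w, (x, y)) has law P in w and [gamma] in (x, y), and almost surely [f w]
   and x share a grid cell. *)
have [pi0 [pi1 pi2 piq]] := coupling_over_nat mqf mq1 qE.
have mfst g : measurable_fun setT (fun z : T * ('rV[R]_d * 'rV[R]_d) => g z.1).
  exact: (measurableT_comp (L2fun_measurable g) measurable_fst).
have my : measurable_fun setT (fun z : T * ('rV[R]_d * 'rV[R]_d) => z.2.2).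
  exact: (measurableT_comp measurable_snd measurable_snd).
have mx : measurable_fun setT (fun z : T * ('rV[R]_d * 'rV[R]_d) => z.2.1).
  exact: (measurableT_comp measurable_fst measurable_snd).
have UE g : ((U P nu (pi g))%:E <=
    \int[pi0]_z (sqnormrv (g z.1 - z.2.2))%:E)%E.
  rewrite /U fineK//; apply: W2sq_le => // A mA.
    rewrite lawE// -pi1; first by congr (pi0 _); rewrite setXT.
    by rewrite -[X in measurable X]setTI; exact: L2fun_measurable.
  have [_ <-] := gc A mA; rewrite -pi2; last exact: measurableX.
  by rewrite !setTX.
have nneg (x : 'rV[R]_d) : (0 <= (sqnormrv x)%:E)%E.
  by rewrite lee_fin sqnormrv_ge0.
have t01 : 0 <= t * (1 - t) by rewrite mulr_ge0// subr_ge0.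
(* Both costs use the same y, so the pointwise identity can be integrated as it stands. *)
have splitE : (\int[pi0]_z ((1 - t)%:E * (sqnormrv (f1 z.1 - z.2.2))%:E +
      t%:E * (sqnormrv (f2 z.1 - z.2.2))%:E) =
    \int[pi0]_z ((sqnormrv (f z.1 - z.2.2))%:E +
      (t * (1 - t))%:E * (sqnormrv (f1 z.1 - f2 z.1))%:E))%E.
  apply: eq_integral => z _; rewrite -!EFinM -!EFinD; congr EFin.
  exact: sqnormrv_convex.
have m1 := measurable_sqnormrvB (mfst f1) my.
have m2 := measurable_sqnormrvB (mfst f2) my.
have m3 := measurable_sqnormrvB (mfst f) my.
have m4 := measurable_sqnormrvB (mfst f1) (mfst f2).
have m5 := measurable_sqnormrvB (mfst f) mx.
have m6 := measurable_sqnormrvB mx my.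
have t1' : (0 <= (1 - t)%:E)%E by rewrite lee_fin subr_ge0.
rewrite -lee_fin EFinD !EFinM.
apply: (@le_trans _ _ ((1 - t)%:E * \int[pi0]_z (sqnormrv (f1 z.1 - z.2.2))%:E +
  t%:E * \int[pi0]_z (sqnormrv (f2 z.1 - z.2.2))%:E)%E).
  by apply: leeD; apply: lee_wpmul2l.
have mZ k (h : T * ('rV[R]_d * 'rV[R]_d) -> R) :
    measurable_fun setT (fun z => (h z)%:E) ->
    measurable_fun setT (fun z => k%:E * (h z)%:E)%E.
  by move=> mh; exact: measurable_funeM.
have nnegZ k (x : 'rV[R]_d) : 0 <= k -> (0 <= k%:E * (sqnormrv x)%:E)%E.
  by move=> k0; rewrite mule_ge0.
rewrite -(ge0_integralZl pi0 measurableT m1)//.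
rewrite -(ge0_integralZl pi0 measurableT m2)//.
rewrite -(ge0_integralD pi0 measurableT)//; last 4 first.
- by move=> z _; apply: nnegZ; rewrite subr_ge0.
- exact: mZ.
- by move=> z _; exact: nnegZ.
- exact: mZ.
rewrite splitE (ge0_integralD pi0 measurableT)//; last 2 first.
- by move=> z _; exact: nnegZ.
- exact: mZ.
rewrite (ge0_integralZl pi0 measurableT m4)// EFinD; apply: leeD.
  (* Young's inequality for [f - y = (x - y) + (f - x)]: the squared mesh is [s^2], and
     [(1 + s^-1) * s^2 = s^2 + s]. *)
  apply: (@le_trans _ _ (\int[pi0]_z ((1 + s)%:E *
      (sqnormrv (z.2.1 - z.2.2))%:E + (s ^+ 2 + s)%:E))%E).
    apply: ae_ge0_le_integral => //.
    - by move=> z _; rewrite adde_ge0 ?nnegZ ?lee_fin ?addr_ge0 ?sqr_ge0 ?ltW.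
    - by apply: emeasurable_funD; [exact: mZ|exact: measurable_cst].
    apply: filterS piq => z /= qz _; rewrite -EFinM -EFinD lee_fin.
    have -> : f z.1 - z.2.2 = (z.2.1 - z.2.2) + (f z.1 - z.2.1).
      by rewrite [RHS]addrC addrA subrK.
    apply: (le_trans (sqnormrvD_young _ _ s0)); rewrite lerD2l.
    have -> : s ^+ 2 + s = (1 + s^-1) * s ^+ 2 by field; rewrite gt_eqF.
    by rewrite ler_wpM2l ?qs// addr_ge0// invr_ge0 ltW.
  rewrite (ge0_integralD pi0 measurableT)//; last 3 first.
  - by move=> z _; rewrite nnegZ// addr_ge0// ltW.
  - exact: mZ.
  - by move=> z _; rewrite lee_fin addr_ge0 ?sqr_ge0 ?ltW.
  rewrite (ge0_integralZl pi0 measurableT m6)//; last first.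
    by rewrite lee_fin addr_ge0// ltW.
  rewrite (_ : \int[pi0]_z (s ^+ 2 + s)%:E = (s ^+ 2 + s)%:E)%E; last first.
    rewrite (integral_cst pi0 measurableT).
    by rewrite [X in (_ * X)%E]probability_setT mule1.
  rewrite [leRHS]EFinD [((1 + s) * c)%:E]EFinM leeD2r//.
  have mg : measurable_fun setT
      (fun z : 'rV[R]_d * 'rV[R]_d => (sqnormrv (z.1 - z.2))%:E).
    exact: measurable_sqnormrvB measurable_fst measurable_snd.
  by rewrite (ge0_integral_marginal2 pi2 mg)// cE.
rewrite [leRHS]EFinM -integral_sqnormrv_L2fun.
have mf : measurable_fun setT (fun w => (sqnormrv (f1 w - f2 w))%:E).
  exact: measurable_sqnormrvB (L2fun_measurable f1) (L2fun_measurable f2).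
by rewrite (ge0_integral_marginal1 pi1 mf).
Qed.

(** Apply [semiconcave_coupling] to every coupling of finite cost and let s tend to 0; existence of
    an optimal coupling is never invoked. *)
Lemma U_semiconcave x1 x2 t : 0 <= t <= 1 ->
  (1 - t) * U P nu x1 + t * U P nu x2 <=
  U P nu ((1 - t) *: x1 + t *: x2) + t * (1 - t) * inner (x1 - x2) (x1 - x2).
Proof.
move=> t01; have [f1 ->] := piL2_surj x1; have [f2 ->] := piL2_surj x2.
have -> : pi f1 - pi f2 = pi (f1 - f2).
  by rewrite /pi -scaleN1r -piL2Z -piL2D scaleN1r.
rewrite innerE -/(pi f1) -/(pi f2) -!piL2Z -piL2D -/(pi _).
set I := _ * dotL2fun _ _; set f := (1 - t) *: f1 + t *: f2.
rewrite -lerBlDr -lee_fin {3}/U fineK//.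
apply: le_ereal_inf_tmp => _ [gamma gc <-].
have ge0 : (0 <= \int[gamma]_z (sqnormrv (z.1 - z.2))%:E)%E.
  by apply: integral_ge0 => z _; rewrite lee_fin sqnormrv_ge0.
have [gE|gfin] := eqVneq (\int[gamma]_z (sqnormrv (z.1 - z.2))%:E)%E +oo%E.
  by rewrite gE leey.
rewrite -ltey -ge0_fin_numE// in gfin; rewrite -(fineK gfin) lee_fin.
set c := fine _; have c0 : 0 <= c by exact: fine_ge0.
apply/ler_addgt0Pr => e e0; rewrite lerBlDr.
(* For [s <= 1] the excess [s * c + s^2 + s] is at most [s * (c + 2)], hence at most [e]. *)
pose s := Num.min 1 (e / (c + 2)).
have s0 : 0 < s by rewrite lt_min ltr01 divr_gt0// ltr_wpDl.
have s1 : s <= 1 by rewrite ge_min lexx.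
have sc : s * (c + 2) <= e.
  by rewrite -ler_pdivlMr ?ltr_wpDl// ge_min lexx orbT.
apply: (le_trans (semiconcave_coupling t01 s0 gc (esym (fineK gfin)))).
rewrite -/I -/c lerD2r; have : s ^+ 2 <= s by rewrite expr2 ger_pMl.
by lra.
Qed.

End semiconcavity.

(** * Completeness of H *)

Lemma sum_half_le (R : realType) n : \sum_(k < n) 2^-1 ^+ k <= 2 :> R.
Proof.
have := @geometric_le_lim R n 1 2^-1 ler01 (ltac:(by rewrite invr_gt0)).
rewrite gtr0_norm ?invr_gt0// => /(_ (ltac:(by rewrite invf_lt1// ltr1n))).
rewrite [X in _ <= X](_ : _ = 2 :> R); last by field.
apply: le_trans; rewrite seriesEord /=.
by apply: ler_sum => k _; rewrite /= mul1r.
Qed.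

(** Each increment b satisfies [|b| <= 2^k b^2 + 2^-k], so the telescoping series converges
    absolutely. *)
Lemma weighted_sqr_sum_cvgn (R : realType) (a : R ^nat) (M : R) :
  (forall n, \sum_(k < n) 2 ^+ k * (a k.+1 - a k) ^+ 2 <= M) -> cvgn a.
Proof.
move=> aM.
have : cvgn (series (telescope a)).
  apply: normed_cvg; apply: nondecreasing_is_cvgn.
    apply/nondecreasing_seqP => n.
    by rewrite [leRHS]seriesSr lerDl; exact: normr_ge0.
  exists (M + 2) => _ [n _ <-].
  rewrite -[leLHS]/(series (fun k => `|telescope a k|) n) seriesEord /=.
  apply: le_trans (lerD (aM n) (sum_half_le R n)).
  rewrite -big_split /=; apply: ler_sum => k _.
  rewrite /telescope /=; set b := a k.+1 - a k.
  have c0 : 0 < 2 ^+ k :> R by rewrite exprn_gt0.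
  rewrite exprVn -subr_ge0 -(pmulr_rge0 _ c0) -(real_normK (num_real b)).
  rewrite (_ : _ * _ = (2 ^+ k * `|b| - 2^-1) ^+ 2 + 3 / 4).
    by rewrite addr_ge0 ?sqr_ge0// divr_ge0.
  by field; rewrite gt_eqF.
rewrite telescopeK => /cvg_ex[l al]; apply/cvg_ex; exists (l + a 0%N).
have : (fun n => [sequence a n - a 0%N]_n n + a 0%N) @ \oo --> l + a 0%N.
  by apply: cvgD => //; exact: cvg_cst.
by rewrite (_ : (fun n => _ + _) = a)//; apply/funext => n /=; rewrite subrK.
Qed.

Section completeness.
Context d0 (T : measurableType d0) (R : realType) (P : probability T R)
  (d : nat).
Implicit Types (f g : L2fun P d) (u : (L2 P d)^nat).

Lemma L2normE (x : L2 P d) : `|x| ^+ 2 = inner x x.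
Proof. by rewrite sqr_sqrtr ?inner_ge0. Qed.

Lemma integral_sqnormrvB_L2fun f g :
  (\int[P]_w (sqnormrv (f w - g w))%:E =
   (`|\pi_(L2 P d)%qT f - \pi_(L2 P d)%qT g| ^+ 2)%:E)%E.
Proof.
have -> : (\pi_(L2 P d) f - \pi_(L2 P d) g = \pi_(L2 P d) (f - g))%qT.
  by rewrite -scaleN1r -piL2Z -piL2D scaleN1r.
by rewrite L2normE innerE -integral_sqnormrv_L2fun.
Qed.

Lemma rapid_dist_le (V : normedModType R) (u : V ^nat) :
  (forall n, `|u n.+1 - u n| <= 2^-1 ^+ n) ->
  forall n m, `|u (n + m)%N - u n| <= 2 * 2^-1 ^+ n.
Proof.
move=> du n m.
(* Subtracting the tail of the geometric series makes the bound inductive in m. *)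
have : `|u (n + m)%N - u n| <= 2 * 2^-1 ^+ n - 2 * 2^-1 ^+ (n + m).
  elim: m => [|m ih]; first by rewrite addn0 !subrr normr0.
  rewrite addnS -(subrKA (u (n + m)%N)).
  apply: (le_trans (ler_normD _ _)).
  apply: (le_trans (lerD (du _) ih)).
  by rewrite exprS mulrA mulfV// mul1r; lra.
move=> /le_trans; apply; rewrite gerBl mulr_ge0// exprn_ge0// invr_ge0.
Qed.

(** Riesz-Fischer argument: representatives converge almost everywhere, and Fatou's lemma turns this
    into convergence in norm with a rate. *)
Lemma L2_rapid_cvg u : (forall n, `|u n.+1 - u n| <= 2^-1 ^+ n) ->
  exists x, forall n, `|u n - x| <= 2 * 2^-1 ^+ n.
Proof.
move=> du; pose f n := repr (u n).
have uE n : u n = (\pi_(L2 P d) (f n))%qT by rewrite /f reprK.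
have mD m n : measurable_fun setT (fun w => (sqnormrv (f m w - f n w))%:E).
  exact: measurable_sqnormrvB (L2fun_measurable _) (L2fun_measurable _).
have D0 m n w : (0 <= (sqnormrv (f m w - f n w))%:E)%E.
  by rewrite lee_fin sqnormrv_ge0.
(* The weight [2^n] leaves the integrals summable, as they are at most [2^-n], and matches the
   hypothesis of [weighted_sqr_sum_cvgn]. *)
pose D n w := ((2 ^+ n)%:E * (sqnormrv (f n.+1 w - f n w))%:E)%E.
have D0' n w : (0 <= D n w)%E by rewrite mule_ge0// lee_fin exprn_ge0.
have mD' n : measurable_fun setT (D n) by exact: measurable_funeM.
have iD : P.-integrable setT (fun w => \sum_(n <oo) D n w)%E.
  apply/integrableP; split; first exact: ge0_emeasurable_sum.
  under eq_integral do rewrite gee0_abs ?nneseries_ge0//.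
  rewrite integral_nneseries//.
  apply: (@le_lt_trans _ _ 2%:E); last exact: ltry.
  apply: lime_le; first by apply: is_cvg_nneseries => *; exact: integral_ge0.
  apply: nearW => n; rewrite big_mkord.
  apply: (@le_trans _ _ (\sum_(k < n) (2^-1 ^+ k)%:E)%E).
    apply: lee_sum => k _.
    have c0 : (0 <= (2 ^+ k)%:E :> \bar R)%E by rewrite lee_fin exprn_ge0.
    rewrite /D (ge0_integralZl P measurableT (mD _ _) (fun w _ => D0 _ _ w) c0).
    rewrite integral_sqnormrvB_L2fun -!uE -EFinM lee_fin.
    have h := du k; have k0 : 0 < 2 ^+ k :> R by rewrite exprn_gt0.
    rewrite -ler_pdivlMl// exprVn in h *; rewrite -expr2.
    by rewrite ler_sqr// ?nnegrE// invr_ge0 ltW.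
  by rewrite sumEFin lee_fin sum_half_le.
(* The upper limit is defined and measurable everywhere, and it is the genuine limit almost
   everywhere. *)
pose F w i := limn_esup (fun n => (f n w 0 i)%:E).
have mF i : measurable_fun setT (fun w => fine (F w i)).
  apply: measurableT_comp => //; apply: measurable_fun_limn_esup => n.
  by apply/measurable_EFinP; have /measurable_fun_rVP := L2fun_measurable (f n).
have aeF : {ae P, forall w, forall i, f n w 0 i @[n --> \oo] --> fine (F w i)}.
  apply: filterS (integrable_ae measurableT iD) => w /(_ I) wfin i.
  have : cvgn (fun n => f n w 0 i).
    apply: (@weighted_sqr_sum_cvgn _ _ (fine (\sum_(n <oo) D n w)%E)) => n.
    rewrite -lee_fin fineK//.
    apply: (le_trans _ (nneseries_lim_ge n (fun k _ _ => D0' k w))).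
    rewrite big_mkord -sumEFin; apply: lee_sum => k _.
    rewrite /D -EFinM lee_fin ler_wpM2l ?exprn_ge0//.
    rewrite /sqnormrv /dotrv (bigD1 i)//= !mxE -expr2 lerDl.
    by apply: sumr_ge0 => j _; rewrite -expr2 sqr_ge0.
  move=> /cvg_ex[l fl].
  have fl' : ((f n w 0 i)%:E @[n --> \oo] --> l%:E)%E 
    by apply: cvg_EFin; [exact: nearW|exact: fl].
  by rewrite /F; have [_ ->] := cvg_limn_einf_sup fl'.
pose h w : 'rV[R]_d := \row_i fine (F w i).
have mh : measurable_fun setT h.
  apply/measurable_fun_rVP => i.
  rewrite (_ : (fun _ => _) = (fun w => fine (F w i)))//.
  by apply/funext => w; rewrite mxE.
have hf n : (\int[P]_w (sqnormrv (h w - f n w))%:E <=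
    ((2 * 2^-1 ^+ n) ^+ 2)%:E)%E.
  apply: (@le_trans _ _ (\int[P]_w
      limn_einf (fun m => (sqnormrv (f (n + m)%N w - f n w))%:E))%E).
    apply: ae_ge0_le_integral => //.
    - by move=> w _; rewrite lee_fin sqnormrv_ge0.
    - exact: measurable_sqnormrvB mh (L2fun_measurable _).
    - move=> w _; rewrite limn_einf_lim; apply: lime_ge.
        exact: is_cvg_einfs.
      apply: nearW => m; apply: le_ereal_inf_tmp => _ [k _ <-].
      by rewrite lee_fin sqnormrv_ge0.
    - apply: measurableT_comp => //; apply: measurable_fun_limn_esup => m.
      by apply: measurableT_comp => //; exact: mD.
    apply: filterS aeF => w wF _.
    have : ((sqnormrv (f (n + m)%N w - f n w))%:E @[m --> \oo] -->
       (sqnormrv (h w - f n w))%:E)%E.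
      apply: cvg_EFin; first exact: nearW.
      apply: cvg_big => [|i _]; first exact: add_continuous.
      rewrite !mxE.
      have fi : f (n + m)%N w 0 i - f n w 0 i @[m --> \oo] -->
          fine (F w i) - f n w 0 i.
        apply: cvgB; last exact: cvg_cst.
        under eq_fun do rewrite addnC.
        by have := wF i; rewrite -(cvg_shiftn n).
      by under eq_fun do rewrite !mxE; exact: cvgM.
    by move=> /cvg_limn_einf_sup[-> _].
  apply: (le_trans (fatou _ _ _ _)) => //.
  rewrite limn_einf_lim; apply: lime_le; first exact: is_cvg_einfs.
  apply: nearW => m; apply: ge_ereal_inf.
  exists (\int[P]_w (sqnormrv (f (n + m)%N w - f n w))%:E)%E.
    by exists m => //=.
  rewrite integral_sqnormrvB_L2fun -!uE lee_fin.
  by rewrite ler_sqr ?nnegrE ?rapid_dist_le.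
(* The case n = 0 of [hf] gives square integrability of [h - f 0]; adding [f 0] back then places [h]
   in the space. *)
have hL2 : (fun w => h w - f 0%N w) \in @sqint _ T R P d.
  apply/asboolP; split; last exact: le_lt_trans (hf 0%N) (ltry _).
  exact: measurable_rVB mh (L2fun_measurable _).
pose g : L2fun P d := MkL2fun hL2 + f 0%N.
have gE w : g w = h w.
  by rewrite /g [LHS](_ : _ = h w - f 0%N w + f 0%N w)// subrK.
exists (\pi_(L2 P d) g)%qT => n.
rewrite distrC -ler_sqr ?nnegrE//.
rewrite uE -lee_fin -integral_sqnormrvB_L2fun.
by apply: le_trans (hf n); under eq_integral do rewrite gE.
Qed.

End completeness.

(** * Envelopes of semiconcave functions on H *)

Section hilbert.
Context d0 (T : measurableType d0) (R : realType) (P : probability T R)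
  (d : nat).
Local Notation H := (L2 P d).
Implicit Types (x y z p : H) (V : H -> R).

Lemma innerDr x y z : inner z (x + y) = inner z x + inner z y.
Proof. by rewrite innerC innerDl !(innerC _ z). Qed.

Lemma innerZr a x z : inner z (a *: x) = a * inner z x.
Proof. by rewrite innerC innerZl innerC. Qed.

Lemma innerNl x z : inner (- x) z = - inner x z.
Proof. by rewrite -scaleN1r innerZl mulN1r. Qed.

Lemma innerNr x z : inner z (- x) = - inner z x.
Proof. by rewrite innerC innerNl innerC. Qed.

Let inner_simp := (innerDl, innerDr, innerNl, innerNr, innerZl, innerZr).

Lemma inner_le x y : inner x y <= `|x| * `|y|.
Proof. exact: inner_cauchy_schwarz. Qed.

Lemma inner_ext x y : (forall z, inner x z = inner y z) -> x = y.
Proof.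
move=> xy; apply/subr0_eq/inner_eq0.
by rewrite innerDl innerNl xy subrr.
Qed.

(** This is concavity of [V - |.|^2]. The constant 1 is what a penalty with [delta^-1 > 1]
    overcomes. *)
Definition semiconcave V := forall t x y, 0 <= t <= 1 ->
  (1 - t) * V x + t * V y <=
  V ((1 - t) *: x + t *: y) + t * (1 - t) * `|x - y| ^+ 2.

(** * Sup-convolution of a semiconcave function *)

Section regularization.
Variables (V : H -> R) (delta : R).
Hypotheses (scV : semiconcave V) (d0' : 0 < delta) (d1 : delta < 1).

Definition penalized x y := V y - delta^-1 * `|x - y| ^+ 2.

Definition envelope x := sup [set penalized x y | y in [set: H]].

(* [xs] is the limit of the maximizing sequences and [m] the limit of [V] along
   them; [V] is not assumed upper semicontinuous, so [m] may differ from
   [V xs]. *)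
Definition regularized_max x xs m := let p := (2 / delta) *: (xs - x) in
  [/\ envelope x = m - delta^-1 * `|x - xs| ^+ 2,
      forall e, 0 < e -> exists y, `|y - xs| <= e /\ `|V y - m| <= e &
      forall y, V y <= m + inner p (y - xs) + `|y - xs| ^+ 2].

(** Modulus of strong concavity left once the penalty has compensated the semiconcavity defect. *)
Let kappa := delta^-1 - 1.

Let kappa_gt0 : 0 < kappa.
Proof. by rewrite subr_gt0 invf_gt1. Qed.

Lemma penalized_strong_concave x a b t : 0 <= t <= 1 ->
  (1 - t) * penalized x a + t * penalized x b +
    kappa * (t * (1 - t)) * `|a - b| ^+ 2 <=
  penalized x ((1 - t) *: a + t *: b).
Proof.
move=> t01; have := scV a b t01; rewrite /penalized.
rewrite (_ : `|x - ((1 - t) *: a + t *: b)| ^+ 2 =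
   (1 - t) * `|x - a| ^+ 2 + t * `|x - b| ^+ 2 - t * (1 - t) * `|a - b| ^+ 2).
  by rewrite /kappa; lra.
rewrite !L2normE !inner_simp (innerC a x) (innerC b x) (innerC b a); ring.
Qed.

(** Strong concavity at midpoints makes a fast maximizing sequence Cauchy; completeness provides
    [xs]. *)
Lemma regularized_max_exists x M : (forall y, penalized x y <= M) ->
  exists xs m, regularized_max x xs m.
Proof.
move=> FM; set A := [set penalized x y | y in [set: H]].
have supA : has_sup A.
  by split; [exists (penalized x 0), 0|exists M => _ [y _ <-]].
have FS y : penalized x y <= sup A by apply: sup_upper_bound => //; exists y.
(* The midpoint inequality bounds [kappa / 4 * |u (n+1) - u n|^2] by the mean of two consecutive
   [eta], hence by [eta n]. *)
pose eta n : R := kappa / 4 * (2^-1 ^+ n) ^+ 2.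
have h0 n : 0 < 2^-1 ^+ n :> R by rewrite exprn_gt0// invr_gt0.
have eta0 n : 0 < eta n by rewrite mulr_gt0 ?divr_gt0// exprn_gt0.
have [u uP] : {u : nat -> H & forall n, sup A - eta n < penalized x (u n)}.
  apply: (@choice _ _ (fun n y => sup A - eta n < penalized x y)) => n.
  by have [_ [y _ <-] ?] := sup_adherent (eta0 n) supA; exists y.
have du n : `|u n.+1 - u n| <= 2^-1 ^+ n.
  have hn0 := ltW (h0 n); rewrite -ler_sqr ?nnegrE//.
  have half : 0 <= (2^-1 : R) <= 1 by rewrite invr_ge0 ler0n invf_le1 ?ler1n.
  have := le_trans (penalized_strong_concave x (u n.+1) (u n) half) (FS _).
  have : eta n.+1 <= eta n.
    rewrite ler_pM2l ?divr_gt0// ler_sqr ?nnegrE ?ltW// exprS gtr_pMl//.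
    by rewrite invf_lt1// ltr1n.
  have := uP n; have := uP n.+1.
  have -> : eta n = kappa / 4 * (2^-1 ^+ n) ^+ 2 by [].
  set c := `|_| ^+ 2; set b := _ ^+ 2 => ? ? ? ?.
  have : kappa / 4 * c <= kappa / 4 * b by lra.
  by rewrite ler_pM2l ?divr_gt0//.
have [xs xsP] := L2_rapid_cvg du.
have hn : 2^-1 ^+ n @[n --> \oo] --> (0 : R).
  have := @cvg_geometric R 1 2^-1; rewrite gtr0_norm ?invr_gt0//.
  move=> /(_ (ltac:(by rewrite invf_lt1// ltr1n))).
  by rewrite -exprn_geometric.
have uxs : u @ \oo --> xs.
  apply/cvgrPdist_le => e e0.
  have e20 : 0 < e / 2 by rewrite divr_gt0.
  near=> n; rewrite distrC (le_trans (xsP n))//.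
  rewrite mulrC -ler_pdivlMr//.

  apply: le_trans (ler_norm _) _.
  by near: n; move/cvgr0Pnorm_le : hn; apply.
have usq y : `|y - u n| ^+ 2 @[n --> \oo] --> `|y - xs| ^+ 2.
  have yu : `|y - u n| @[n --> \oo] --> `|y - xs|.
    by apply: cvg_norm; apply: cvgB => //; exact: cvg_cst.
  by under eq_fun do rewrite expr2; rewrite expr2; exact: cvgM.
exists xs, (sup A + delta^-1 * `|x - xs| ^+ 2); split.
- by rewrite addrK.
- move=> e e0.
  have Vu : V (u n) @[n --> \oo] --> sup A + delta^-1 * `|x - xs| ^+ 2.
    rewrite (_ : (fun _ => _) = (fun n =>
        penalized x (u n) + delta^-1 * `|x - u n| ^+ 2)); last first.
      by apply/funext => n; rewrite /penalized subrK.
    suff FA : penalized x (u n) @[n --> \oo] --> sup A.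
      have := cvgD FA (cvgM (cvg_cst delta^-1) (usq x)).
      by apply.
    apply: (@squeeze_cvgr _ _ _ _ (fun n => sup A - eta n) (fun=> sup A)).
    - by apply: nearW => n; rewrite FS ltW.
    - have := cvgB (cvg_cst (sup A)) (cvgM (cvg_cst (kappa / 4)) (cvgM hn hn)).
      by rewrite !mulr0 subr0; apply.
    - exact: cvg_cst.
  near \oo => n; exists (u n); split.
    by rewrite distrC; near: n; move/cvgrPdist_le : uxs; apply.
  by rewrite distrC; near: n; move/cvgrPdist_le : Vu; apply.
move=> y.
(* Use strong concavity between y and [u n] with weight [h = 2^-n] on y, then divide by h. The error
   [eta n] is of order [h^2], so it still vanishes after the division. *)
have key : penalized x y + kappa * `|y - xs| ^+ 2 <= sup A.
  apply: (@ler_cvg_to nat \oo _ R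
    (fun n => penalized x y + kappa * (1 - 2^-1 ^+ n) * `|y - u n| ^+ 2)
    (fun n => sup A + kappa / 4 * ((1 - 2^-1 ^+ n) * 2^-1 ^+ n))).
  - have := cvgD (cvg_cst (penalized x y))
      (cvgM (cvgM (cvg_cst kappa) (cvgB (cvg_cst (1 : R)) hn)) (usq y)).
    by rewrite subr0 mulr1; apply.
  - have := cvgD (cvg_cst (sup A))
      (cvgM (cvg_cst (kappa / 4)) (cvgM (cvgB (cvg_cst (1 : R)) hn) hn)).
    by rewrite !mulr0 addr0; apply.
  apply: nearW => n; set h := 2^-1 ^+ n.
  have hgt0 : 0 < h by exact: h0.
  have h1 : h <= 1 by rewrite exprn_ile1 ?invr_ge0// invf_le1// ler1n.
  have t01 : 0 <= 1 - h <= 1 by rewrite subr_ge0 h1 gerBl ltW.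
  have H1 := le_trans (penalized_strong_concave x y (u n) t01) (FS _).
  have hu : penalized x (u n) >= sup A - kappa / 4 * h ^+ 2 by exact/ltW/uP.
  have H2 := ler_wpM2l (ltac:(by case/andP : t01) : 0 <= 1 - h) hu.
  rewrite -(ler_pM2l hgt0); move: H1 H2.
  rewrite (_ : 1 - (1 - h) = h); last by ring.
  set c := `|_| ^+ 2; set a := penalized x y; set b := penalized x _ => H1 H2.
  by lra.
move: key; rewrite /penalized /kappa.
(* The cross term yields [p], and [delta^-1 - kappa = 1] leaves exactly [|y - xs|^2]. *)
rewrite (_ : `|x - y| ^+ 2 =
    `|x - xs| ^+ 2 + 2 * inner (xs - x) (y - xs) + `|y - xs| ^+ 2).
  by rewrite innerZl; lra.
rewrite !L2normE !inner_simp (innerC xs x) (innerC y x) (innerC y xs); ring.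
Unshelve. all: by end_near. Qed.

(** The supergradient inequality at [xs] bounds the envelope at [x + h] from above, and testing its
    supremum near [xs] bounds it from below. *)
Lemma envelope_quadratic x xs m : regularized_max x xs m ->
  exists C, forall h,
  `|envelope (x + h) - envelope x - inner ((2 / delta) *: (xs - x)) h|
    <= C * `|h| ^+ 2.
Proof.
move=> [envx Vm Vle]; exists (kappa^-1 * delta^-1 ^+ 2 + delta^-1) => h.
have D0 : 0 < delta^-1 by rewrite invr_gt0.
have ub y : penalized (x + h) y <= envelope x +
    inner ((2 / delta) *: (xs - x)) h + kappa^-1 * delta^-1 ^+ 2 * `|h| ^+ 2.
  (* Completing this square absorbs the cross term in h and [y - xs], so the bound becomes uniform
     in y. *)
  have sq : 0 <= kappa^-1 * `|kappa *: (y - xs) - delta^-1 *: h| ^+ 2.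
    by rewrite mulr_ge0 ?sqr_ge0// invr_ge0 ltW.
  rewrite (_ : _ * _ = kappa * `|y - xs| ^+ 2
      - 2 * delta^-1 * inner h (y - xs)
      + kappa^-1 * delta^-1 ^+ 2 * `|h| ^+ 2) in sq;
    last first.
    rewrite !L2normE !inner_simp (innerC xs h) (innerC y h) (innerC y xs).
    by field; rewrite !gt_eqF.
  have e : inner ((2 / delta) *: (xs - x)) (y - xs) + `|y - xs| ^+ 2 -
      delta^-1 * `|x + h - y| ^+ 2 = - (delta^-1 * `|x - xs| ^+ 2) +
      inner ((2 / delta) *: (xs - x)) h - delta^-1 * `|h| ^+ 2 -
      kappa * `|y - xs| ^+ 2 + 2 * delta^-1 * inner h (y - xs).
    rewrite !L2normE !inner_simp ?(innerC xs h) ?(innerC y h) ?(innerC y xs).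
    rewrite ?(innerC h x) ?(innerC xs x) ?(innerC y x) ?(innerC h xs) /kappa.
    by field; rewrite gt_eqF.
  have h0 : 0 <= delta^-1 * `|h| ^+ 2 by rewrite mulr_ge0 ?sqr_ge0// ltW.
  by have := Vle y; rewrite envx /penalized; lra.
have nub : has_ubound [set penalized (x + h) y | y in [set: H]].
  by eexists => _ [y _ <-]; exact: ub.
have upper : envelope (x + h) <= envelope x +
    inner ((2 / delta) *: (xs - x)) h + kappa^-1 * delta^-1 ^+ 2 * `|h| ^+ 2.
  apply: ge_sup; first by exists (penalized (x + h) 0), 0.
  by move=> _ [y _ <-]; exact: ub.
have lower : m - delta^-1 * `|x + h - xs| ^+ 2 <= envelope (x + h).
  set a := `|x + h - xs|; have a0 : 0 <= a by exact: normr_ge0.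
  apply/ler_addgt0Pr => e e0.
  (* As [m] need not be [V xs], a point y within b of [xs] is tested instead. For [b <= 1] the loss
     [b + delta^-1 * (2 a b + b^2)] is at most [b * c]. *)
  pose c := 1 + delta^-1 * (2 * a + 1).
  have c0 : 0 < c by rewrite addr_gt0// mulr_gt0// ltr_wpDl// mulr_ge0.
  pose b := Num.min 1 (e / c).
  have b0 : 0 < b by rewrite lt_min ltr01 divr_gt0.
  have b1 : b <= 1 by rewrite ge_min lexx.
  have bc : b * c <= e by rewrite -ler_pdivlMr// ge_min lexx orbT.
  have [y [yx Vy]] := Vm b b0.
  have envy : penalized (x + h) y <= envelope (x + h).
    by apply: ub_le_sup => //; exists y.
  have ya : `|x + h - y| <= a + b.
    rewrite -(subrKA xs); apply: (le_trans (ler_normD _ _)).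
    by rewrite lerD2l distrC.
  have : delta^-1 * `|x + h - y| ^+ 2 <= delta^-1 * (a + b) ^+ 2.
    by rewrite ler_pM2l// ler_sqr ?nnegrE// addr_ge0// ltW.
  have : delta^-1 * (2 * a * b + b ^+ 2) <= delta^-1 * ((2 * a + 1) * b).
    have : b ^+ 2 <= b by rewrite expr2 ger_pMl.
    by rewrite ler_pM2l//; lra.
  move: Vy bc envy; rewrite ler_distl /penalized /c => /andP[Vy _].
  by lra.
have e : m - delta^-1 * `|x + h - xs| ^+ 2 = envelope x +
    inner ((2 / delta) *: (xs - x)) h - delta^-1 * `|h| ^+ 2.
  rewrite envx !L2normE !inner_simp ?(innerC xs h).
  rewrite ?(innerC h x) ?(innerC xs x) ?(innerC h xs).
  by field; rewrite gt_eqF.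
have h0 : 0 <= delta^-1 * `|h| ^+ 2 by rewrite mulr_ge0 ?sqr_ge0// ltW.
have h1 : 0 <= kappa^-1 * delta^-1 ^+ 2 * `|h| ^+ 2.
  by rewrite !mulr_ge0 ?sqr_ge0// invr_ge0 ltW.
by rewrite ler_norml; apply/andP; split; lra.
Qed.

End regularization.

(** * Riesz representation and Frechet gradients *)

Let innerl p : H -> R^o := inner p.

Let innerl_linear p : linear (innerl p).
Proof. by move=> a x y; rewrite /innerl innerDr innerZr. Qed.

HB.instance Definition _ p :=
  GRing.isLinear.Build R H R^o *:%R (innerl p) (innerl_linear p).

Let innerl_continuous p : continuous (innerl p).
Proof.
apply/linear_bounded_continuous/linear_boundedP.
near=> r => x.
apply: (@le_trans _ _ (`|p| * `|x|)); last first.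
  by rewrite ler_wpM2r//; near: r; exact: nbhs_pinfty_ge.
rewrite ler_norml inner_le andbT lerNl.
by rewrite -innerNl -(normrN p) inner_le.
Unshelve. all: by end_near. Qed.

Lemma gradientE (f : H -> R^o) x p :
  (forall h, 'd f x h = inner p h) -> gradient f x = p.
Proof.
move=> dfx; apply: xget_unique => // q dq.
by apply: inner_ext => z; rewrite -dfx -dq.
Qed.

Lemma gradient_quadratic (f : H -> R^o) x p C :
  (forall h, `|f (x + h) - f x - inner p h| <= C * `|h| ^+ 2) ->
  gradient f x = p.
Proof.
move=> fC; apply: gradientE => h.
have -> // : 'd f x = innerl p :> (H -> R^o).
apply: diff_unique; first exact: innerl_continuous.
apply/eqaddoP => e e0; near=> z.
rewrite -[X in `|X| <= _]/(f (z + x) - (f x + inner p z)).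
rewrite (addrC z x) opprD addrA; apply: (le_trans (fC z)).
have C1 : 0 < `|C| + 1 by rewrite ltr_wpDl.
apply: (@le_trans _ _ ((`|C| + 1) * `|z| ^+ 2)).
  by rewrite ler_wpM2r ?sqr_ge0// (le_trans (ler_norm C))// lerDl.
rewrite expr2 mulrA ler_wpM2r// -ler_pdivlMl// mulrC.
near: z; apply: nbhs0_le; exact: divr_gt0.
Unshelve. all: by end_near. Qed.

(** A linear form is semiconcave, so maximizing [l - 2 |.|^2] gives a supergradient [p]; linearity
    forces [l] to be the inner product with it. *)
Lemma riesz (l : {linear H -> R^o}) :
  continuous l -> exists p, forall h, l h = inner p h.
Proof.
move=> cl.
have [K [K0 lK]] : exists K, 0 < K /\ forall x, `|l x| <= K * `|x|.
  have /linear_bounded_continuous/linear_boundedP := cl.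
  move=> /pinfty_ex_gt0[K K0 lK].
  by exists K.
have scl : semiconcave l.
  move=> t x y /andP[t0 t1]; rewrite linearD !linearZ /= lerDl.
  by rewrite !mulr_ge0 ?subr_ge0.
have half0 : 0 < (2^-1 : R) by rewrite invr_gt0.
have half1 : (2^-1 : R) < 1 by rewrite invf_lt1// ltr1n.
have [y|xs [m [_ lm lle]]] :=
    @regularized_max_exists l 2^-1 scl half0 half1 0 (K ^+ 2).
  rewrite /penalized invrK sub0r normrN.
  have := lK y; have := ler_norm (l y); have := sqr_ge0 (K - `|y|).
  by have := sqr_ge0 `|y|; have := sqr_ge0 K; rewrite sqrrB; lra.
set p := _ *: _ in lle; exists p.
(* Here continuity of [l] identifies the limiting value with the value at the limit. *)
have mE : m = l xs.
  apply/subr0_eq/normr0_eq0/eqP; rewrite eq_le normr_ge0 andbT.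
  apply/ler_addgt0Pr => e e0; rewrite add0r.
  have K1 : 0 < K + 1 by rewrite addr_gt0.
  have [y [ye le]] := lm (e / (K + 1)) (divr_gt0 e0 K1).
  rewrite -(subrKA (l y)); apply: (le_trans (ler_normD _ _)).
  rewrite (_ : e = e / (K + 1) + K * (e / (K + 1))); last first.
    by field; rewrite gt_eqF.
  apply: lerD; first by rewrite distrC.
  by rewrite -linearB; apply: (le_trans (lK _)); rewrite ler_wpM2l// ltW.
have le1 h : l h <= inner p h + `|h| ^+ 2.
  have := lle (h + xs).
  by rewrite mE addrK linearD -addrA [leRHS]addrC lerD2r.
(* Apply [le1] to [s *: h], divide by s, and take s small: the quadratic term disappears. *)
have le2 h : l h <= inner p h.
  apply/ler_addgt0Pr => e e0.
  have c0 : 0 < `|h| ^+ 2 + 1 by rewrite ltr_wpDl// sqr_ge0.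
  have s0 := divr_gt0 e0 c0; set s := e / _ in s0.
  have lZ : l (s *: h) = s * l h by rewrite linearZ.
  have := le1 (s *: h); rewrite lZ innerZr normrZ (gtr0_norm s0).
  rewrite (_ : _ + _ = s * (inner p h + s * `|h| ^+ 2)); last by ring.
  rewrite ler_pM2l//.
  move=> /le_trans; apply; rewrite lerD2l.
  have -> : e = s * (`|h| ^+ 2 + 1) by rewrite /s divfK// gt_eqF.
  by rewrite ler_wpM2l ?lerDl// ltW.
move=> h; apply/eqP; rewrite eq_le le2 /=.
by have := le2 (- h); rewrite linearN innerNr lerN2.
Qed.

Definition frechet_gradient V x p := forall e, 0 < e -> exists r, 0 < r /\
  forall h, `|h| < r -> `|V (x + h) - V x - inner p h| <= e * `|h|.

(** [gradient] is meaningful only if a representing vector exists; [riesz] supplies one for the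
    derivative. *)
Lemma differentiable_gradient (f : H -> R^o) x : differentiable f x ->
  frechet_gradient f x (gradient f x).
Proof.
move=> df; have [p dp] := riesz (diff_continuous df).
rewrite (gradientE dp) => e e0.
have /eqaddoP/(_ e e0) := diff_locally df.
move=> /nbhs_ballP[r /= r0 rP]; exists r; split=> // h hr.
have := rP h; rewrite -ball_normE /= sub0r normrN => /(_ hr).
rewrite -[X in `|X| <= _]/(f (h + x) - (f x + 'd f x h)).
by rewrite dp opprD addrA (addrC h).
Qed.

(** * Supergradients near a point of differentiability *)

Section gradient_limit.
Variables (V : H -> R) (x0 p0 : H).
Hypotheses (scV : semiconcave V) (dV : frechet_gradient V x0 p0).

(** Compare semiconcavity on the segment from [x0] to y with the first-order expansion at
    [x0 + t *: z], divide by t, and let t be small. *)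
Lemma semiconcave_le y : V y <= V x0 + inner p0 (y - x0) + `|y - x0| ^+ 2.
Proof.
set z := y - x0; apply/ler_addgt0Pr => e e0.
have z1 : 0 < `|z| + 1 by rewrite ltr_wpDl.
have [r [r0 rP]] := dV (divr_gt0 e0 z1).
pose t := Num.min 1 (r / 2 / (`|z| + 1)).
have t0 : 0 < t by rewrite lt_min ltr01 !divr_gt0.
have t1 : t <= 1 by rewrite ge_min lexx.
have tr : t * (`|z| + 1) <= r / 2 by rewrite -ler_pdivlMr// ge_min lexx orbT.
have tz : `|t *: z| < r by rewrite normrZ gtr0_norm//; lra.
have t01 : 0 <= t <= 1 by rewrite t1 ltW.
have := scV x0 y t01.
rewrite (_ : (1 - t) *: x0 + t *: y = x0 + t *: z); last first.
  by rewrite /z scalerBr scalerBl scale1r addrAC addrA.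
rewrite distrC -/z.
have := rP _ tz; rewrite innerZr normrZ (gtr0_norm t0) ler_distl => /andP[_].
move=> H1 H2.
have H3 : t * (e / (`|z| + 1) * `|z|) <= t * e.
  rewrite ler_pM2l// mulrAC -mulrA ger_pMr// ler_pdivrMr// mul1r lerDl.
  exact: ler01.
have H4 : 0 <= t * t * `|z| ^+ 2 by rewrite !mulr_ge0 ?sqr_ge0// ltW.
by rewrite -(ler_pM2l t0); lra.
Qed.

Variable delta : R.
Hypotheses (delta0 : 0 < delta) (delta4 : delta <= 1 / 4).

Let Dge4 : 4 <= delta^-1.
Proof. by rewrite -[4]invrK lef_pV2 ?posrE ?invr_gt0// -div1r. Qed.

(** By [semiconcave_le], V grows at most like [3/2 |y - x0|^2], hence like [3 |x - y|^2] up to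
    constants; a penalty coefficient of 4 dominates this. *)
Lemma penalized_bounded x : exists M, forall y, penalized V delta x y <= M.
Proof.
exists (V x0 + `|p0| ^+ 2 + 4 * `|x - x0| ^+ 2) => y.
have H1 := semiconcave_le y; have H2 := inner_le p0 (y - x0).
have H3 : `|y - x0| <= `|x - y| + `|x - x0|.
  by rewrite -(subrKA x) (distrC x y) ler_normD.
have H4 : 4 * `|x - y| ^+ 2 <= delta^-1 * `|x - y| ^+ 2.
  by rewrite ler_wpM2r ?sqr_ge0.
rewrite /penalized.
have H5 : `|y - x0| ^+ 2 <= (`|x - y| + `|x - x0|) ^+ 2.
  by rewrite ler_sqr ?nnegrE ?addr_ge0.
have := sqr_ge0 (`|p0| - `|y - x0|); rewrite sqrrB.
have := sqr_ge0 (`|x - y| - `|x - x0|); rewrite sqrrB.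
have := sqr_ge0 `|p0|; have := sqr_ge0 `|y - x0|.
by move: H5; rewrite sqrrD; lra.
Qed.

Variables (x xs : H) (m : R).
Hypothesis xsm : regularized_max V delta x xs m.

(** Testing the supremum at [x] itself gives [delta^-1 * |xs - x|^2 <= m - V x], while [m] grows at
    most quadratically in [|xs - x|]. In the threshold, [|p0| + 2] absorbs that growth and the
    quotient by [e^2] handles the constants. *)
Lemma regularized_max_dist_le e : 0 < e ->
  `|x - x0| <= 1 -> `|V x - V x0| <= 1 ->
  (`|p0| + 2) + (2 * `|p0| + 4) / e ^+ 2 <= delta^-1 -> `|xs - x| <= e.
Proof.
move=> e0 xx0 Vx De; set w := xs - x.
have [envx Vm _] := xsm.
(* The bound of [semiconcave_le] passes to [m] through points near [xs] whose values approach
   [m]. *)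
have m_le : m <= V x0 + `|p0| * `|xs - x0| + `|xs - x0| ^+ 2.
  apply/ler_addgt0Pr => c c0; set a := `|xs - x0|.
  have a0 : 0 <= a by exact: normr_ge0.
  pose k := 1 + `|p0| + 2 * a + 1.
  have k0 : 0 < k by rewrite /k -!addrA !ltr_pwDl// !addr_ge0// mulr_ge0.
  pose b := Num.min 1 (c / k).
  have b0 : 0 < b by rewrite lt_min ltr01 divr_gt0.
  have b1 : b <= 1 by rewrite ge_min lexx.
  have bc : b * k <= c by rewrite -ler_pdivlMr// ge_min lexx orbT.
  have [y [yx Vy]] := Vm b b0.
  have ya : `|y - x0| <= a + b.
    by rewrite -(subrKA xs) (le_trans (ler_normD _ _))// addrC lerD2l.
  have H1 := semiconcave_le y; have H2 := inner_le p0 (y - x0).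
  have H3 : `|p0| * `|y - x0| <= `|p0| * (a + b) by rewrite ler_wpM2l.
  have H4 : `|y - x0| ^+ 2 <= (a + b) ^+ 2.
    by rewrite ler_sqr ?nnegrE// addr_ge0// ltW.
  have H5 : b ^+ 2 <= b by rewrite expr2 ger_pMl.
  move: Vy; rewrite ler_distl => /andP[Vy _].
  by move: H4 bc; rewrite sqrrD /k; lra.
have Vx_le : V x <= m - delta^-1 * `|w| ^+ 2.
  have [M VM] := penalized_bounded x.
  rewrite /w distrC -envx; apply: ub_le_sup; first by exists M => _ [y _ <-].
  by exists x => //; rewrite /penalized subrr normr0 expr0n mulr0 subr0.
have xsx : `|xs - x0| <= `|w| + 1.
  by rewrite -(subrKA x) (le_trans (ler_normD _ _))// lerD2l.
have H1 : `|p0| * `|xs - x0| <= `|p0| * (`|w| + 1) by rewrite ler_wpM2l.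
have H2 : `|xs - x0| ^+ 2 <= (`|w| + 1) ^+ 2.
  by rewrite ler_sqr ?nnegrE// addr_ge0.
have H3 := sqr_ge0 (`|w| - 1); rewrite sqrrB in H3.
have H4 : `|p0| * (2 * `|w|) <= `|p0| * (`|w| ^+ 2 + 1).
  by rewrite ler_wpM2l//; lra.
have H5 : ((`|p0| + 2) + (2 * `|p0| + 4) / e ^+ 2) * `|w| ^+ 2 <=
    delta^-1 * `|w| ^+ 2 by rewrite ler_wpM2r ?sqr_ge0.
have P0 := normr_ge0 p0; have H6 := mulr_ge0 P0 (sqr_ge0 `|w|).
have c0 : 0 < 2 * `|p0| + 4 by lra.
have : (2 * `|p0| + 4) * (`|w| ^+ 2 / e ^+ 2) <= (2 * `|p0| + 4) * 1.
  rewrite mulrA [_ * _ / _]mulrAC.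
  move: Vx; rewrite ler_distl => /andP[Vx _].
  by move: H2; rewrite sqrrD; lra.
rewrite ler_pM2l// ler_pdivrMr ?exprn_gt0// mul1r ler_sqr ?nnegrE//.
by rewrite ltW.
Qed.

(** At [x0 + h], differentiability bounds V from below with slope [p0] and the supergradient bounds
    it from above with slope [p]. For h of length [rho] along [p0 - p], the gap is [rho * |p0 - p|];
    the offset [xs - x0] costs at most half of it. *)
Lemma supergradient_close p e r rho : 0 < e -> 0 < rho -> rho < r ->
  (forall h, `|h| < r -> `|V (x0 + h) - V x0 - inner p0 h| <= e * `|h|) ->
  (forall b, 0 < b -> exists y, `|y - xs| <= b /\ `|V y - m| <= b) ->
  (forall y, V y <= m + inner p (y - xs) + `|y - xs| ^+ 2) ->
  `|xs - x0| <= rho / 2 -> `|p0 - p| <= 4 * e + 8 * rho.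
Proof.
move=> e0 rho0 rhor rP Vm V_le.
have [ee eeE] : exists ee, ee = xs - x0 by eexists.
have [q qE] : exists q, q = p0 - p by eexists.
rewrite -eeE -qE => xsx0.
have [q0|q0] := eqVneq q 0.
  by rewrite q0 normr0 addr_ge0// mulr_ge0// ltW.
have nq : 0 < `|q| by rewrite normr_gt0.
have m_le : m <= V x0 + inner p0 ee + e * `|ee|.
  apply/ler_addgt0Pr => c c0.
  have k0 : 0 < 1 + `|p0| + e by rewrite addr_gt0// ltr_pwDl.
  (* The bound [rho / 4] keeps y within [3/4 rho < r] of [x0], where the expansion holds. *)
  pose b := Num.min (rho / 4) (c / (1 + `|p0| + e)).
  have b0 : 0 < b by rewrite lt_min !divr_gt0.
  have b1 : b <= rho / 4 by rewrite ge_min lexx.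
  have bc : b * (1 + `|p0| + e) <= c by rewrite -ler_pdivlMr// ge_min lexx orbT.
  have [y [yx Vy]] := Vm b b0.
  have yE : y - x0 = ee + (y - xs) by rewrite eeE [RHS]addrC subrKA.
  have yb : `|y - x0| <= `|ee| + b.
    by rewrite yE (le_trans (ler_normD _ _))// lerD2l.
  have yr : `|y - x0| < r by lra.
  have := rP _ yr; rewrite (addrC x0) subrK ler_distl => /andP[_].
  rewrite [in inner _ _]yE innerDr => H1.
  have H2 := inner_le p0 (y - xs).
  have H3 : `|p0| * `|y - xs| <= `|p0| * b by rewrite ler_wpM2l.
  have H4 : e * `|y - x0| <= e * (`|ee| + b) by rewrite ler_pM2l.
  move: Vy; rewrite ler_distl => /andP[Vy _].
  by lra.
pose h := (rho / `|q|) *: q.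
have nh : `|h| = rho.
  by rewrite normrZ gtr0_norm ?divr_gt0// divfK// gt_eqF.
have := rP h; rewrite nh => /(_ rhor); rewrite ler_distl => /andP[H1 _].
have H2 := V_le (x0 + h).
have hE : x0 + h - xs = h - ee by rewrite eeE opprB addrA (addrC x0).
rewrite hE innerDr innerNr in H2.
have H3 : inner p0 h - inner p h = `|q| * rho.
  rewrite -innerNl -innerDl -qE innerZr -L2normE expr2.
  by field; rewrite gt_eqF.
have H4 : inner p0 ee - inner p ee <= `|q| * (rho / 2).
  rewrite -innerNl -innerDl -qE (le_trans (inner_le _ _))//.
  by rewrite ler_wpM2l.
have H5 : `|h - ee| <= rho + rho / 2.
  by rewrite (le_trans (ler_normB _ _))// nh lerD2l.
have H6 : `|h - ee| ^+ 2 <= (rho + rho / 2) ^+ 2.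
  by rewrite ler_sqr ?nnegrE// addr_ge0// ?divr_ge0// ltW.
have H7 : e * `|ee| <= e * (rho / 2) by rewrite ler_pM2l.
have H8 : 0 < rho ^+ 2 by rewrite exprn_gt0.
have H9 : 0 < e * rho by rewrite mulr_gt0.
have : `|q| * (rho / 2) <= (4 * e + 8 * rho) * (rho / 2).
  by move: H6; rewrite sqrrD; lra.
by rewrite ler_pM2r// divr_gt0.
Qed.

End gradient_limit.

End hilbert.

(** * Convergence of the gradients of the envelopes *)

Unset Implicit Arguments.

Theorem theorem5p1 (R : realType) (d0 : measure_display)
    (Omega : measurableType d0) (P : probability Omega R) (d : nat)
    (nu : probability 'rV[R]_d R) (X0 : L2 P d) (X : R -> L2 P d)
    (std_Omega : standard_borel Omega R) (atomless_P : atomless P)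
    (nu2 : (second_moment nu < +oo)%E)
    (dU : differentiable (U P nu) X0)
    (XX0 : `|X delta - X0| @[delta --> 0^'+] --> (0 : R)) :
  gradient (Udelta P nu delta) (X delta) @[delta --> 0^'+]
    --> gradient (U P nu) X0.
Proof.
have scU : semiconcave (U P nu).
  by move=> t x y t01; rewrite L2normE; exact: U_semiconcave.
have dU0 := differentiable_gradient dU.
set p0 := gradient (U P nu) X0 in dU0 *.
apply/cvgrPdist_le => e e0.
(* The final estimate is [4 * (e / 8) + 8 * rho] with [rho <= e / 16], thus at most [e]. *)
have e8 : 0 < e / 8 by rewrite divr_gt0.
have [r [r0 rP]] := dU0 _ e8.
have [r1 [r10 r1P]] := dU0 1 ltr01.
have p1 : 0 < 1 + `|p0| by rewrite ltr_pwDl.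
pose rho := Num.min (e / 16) (r / 2).
have rho0 : 0 < rho by rewrite lt_min !divr_gt0.
have rhor : rho < r by rewrite gt_min; apply/orP; right; lra.
have rhoe : rho <= e / 16 by rewrite ge_min lexx.
have rho4 : 0 < rho / 4 by rewrite divr_gt0.
pose K := (`|p0| + 2) + (2 * `|p0| + 4) / (rho / 4) ^+ 2.
have K0 : 0 < K.
  have q0 := normr_ge0 p0.
  by rewrite addr_gt0 ?divr_gt0 ?exprn_gt0//; lra.
(* The bound 1 serves [regularized_max_dist_le], and [rho / 4] is half of the allowed distance from
   [xs] to [X0]. The last two keep [U P nu (X delta)] within 1 of its value at [X0]. *)
pose b := Num.min (Num.min 1 (rho / 4)) (Num.min (r1 / 2) (1 + `|p0|)^-1).
have b0 : 0 < b by rewrite !lt_min ltr01 rho4 divr_gt0// invr_gt0.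
near=> delta.
have delta0 : 0 < delta by [].
have delta4 : delta <= 1 / 4.
  by near: delta; apply: nbhs_right_le; rewrite divr_gt0.
have deltaK : K <= delta^-1.
  rewrite -[K]invrK lef_pV2 ?posrE ?invr_gt0//.
  by near: delta; apply: nbhs_right_le; rewrite invr_gt0.
have Xb : `|X delta - X0| <= b.
  have : `| `|X delta - X0| | <= b.
    by near: delta; move/cvgr0Pnorm_le : XX0; apply.
  by rewrite normr_id.
have /andP[/andP[X1 Xrho] /andP[Xr1 Xp]] : (`|X delta - X0| <= 1) &&
    (`|X delta - X0| <= rho / 4) && ((`|X delta - X0| <= r1 / 2) &&
    (`|X delta - X0| <= (1 + `|p0|)^-1)) by rewrite -!le_min.
have delta1 : delta < 1 by lra.
have [M UM] := penalized_bounded scU dU0 delta0 delta4 (X delta).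
have [xs [m xsm]] := regularized_max_exists scU delta0 delta1 UM.
have [C UC] := envelope_quadratic delta0 delta1 xsm.
(* [Udelta] is the envelope of [U P nu] by conversion, so its gradient is
   [(2 / delta) *: (xs - X delta)], which is also the supergradient of [U P nu] in [Ule]. *)
rewrite (gradient_quadratic (f := Udelta P nu delta) UC).
have UX : `|U P nu (X delta) - U P nu X0| <= 1.
  have Xr : `|X delta - X0| < r1 by lra.
  have := r1P _ Xr; rewrite (addrC X0) subrK mul1r => H1.
  have H2 : `|inner p0 (X delta - X0)| <= `|p0| * `|X delta - X0|.
    rewrite ler_norml inner_le andbT lerNl.
    by rewrite -innerNl -(normrN p0) inner_le.
  have H3 : (1 + `|p0|) * `|X delta - X0| <= 1 by rewrite -ler_pdivlMl// mulr1.
  rewrite -(subrK (inner p0 (X delta - X0)) (U P nu (X delta) - _)).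
  by apply: (le_trans (ler_normD _ _)); lra.
have xsX := regularized_max_dist_le scU dU0 delta0 delta4 xsm rho4 X1 UX deltaK.
have xsX0 : `|xs - X0| <= rho / 2.
  rewrite -(subrKA (X delta)); apply: (le_trans (ler_normD _ _)).
  by lra.
have [_ Um Ule] := xsm.
apply: (le_trans (supergradient_close e8 rho0 rhor rP Um Ule xsX0)).
by lra.
Unshelve. all: by end_near. Qed.
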